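(* For all integers $d\ge1$ and $k\ge3$, there exists $K>0$ (depending on $d$ and $k$) such that for every integer $n\ge1$, \[R_k^d(n)\le \operatorname{twr}_{k-1}(n^K).\]
   Context: All hypergraphs are finite and simple. A $k$-uniform hypergraph is a hypergraph whose edges all have cardinality $k$. For a set $V$ and a set $\mathcal F$ of subsets of $V$, a subset $S\subseteq V$ is shattered by $\mathcal F$ if for every $A\subseteq S$ there exists $B\in\mathcal F$ with $B\cap S=A$; the VC-dimension of $\mathcal F$ is the largest cardinality of a subset of $V$ shattered by $\mathcal F$. For a $k$-uniform hypergraph $\mathcal H$ and a set $S$ of $k-1$ vertices of $\mathcal H$, let $N_{\mathcal H}(S)=\{v\in V(\mathcal H):S\cup\{v\}\in E(\mathcal H)\}$. The VC-dimension of $\mathcal H$ is the VC-dimension of the family $\{N_{\mathcal H}(S):S\subseteq V(\mathcal H),|S|=k-1\}$ with ground set $V(\mathcal H)$. A clique in $\mathcal H$ is a subset of $V(\mathcal H)$ all of whose $k$-element subsets are in $E(\mathcal H)$, and a stable set is a subset of $V(\mathcal H)$ none of whose $k$-element subsets is in $E(\mathcal H)$. For integers $d\ge1$, $k\ge2$, $n\ge1$, $R_k^d(n)$ is the smallest integer $m\ge1$ such that every $m$-vertex $k$-uniform hypergraph of VC-dimension at most $d$ contains a clique or stable set of size at least $n$. The function $\operatorname{twr}_k$ is defined recursively by $\operatorname{twr}_1(t)=t$ and $\operatorname{twr}_k(t)=2^{\operatorname{twr}_{k-1}(t)}$ for $k\ge 2$ and all $t>0$. *)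

(* Defs.v *)
From mathcomp Require Import all_boot all_order all_algebra.
From mathcomp Require Import reals exp.

Set Implicit Arguments.
Unset Strict Implicit.
Unset Printing Implicit Defensive.

Import Order.TTheory GRing.Theory Num.Theory.

(* A hypergraph is given by a finite vertex type T and an edge set
   E : {set {set T}}; the ground set of a set family is the whole of T. *)

Definition shattered (T : finType) (F : {set {set T}}) (S : {set T}) : bool :=
  [forall A : {set T}, (A \subset S) ==> [exists B in F, B :&: S == A]].

(* The empty family, which shatters no set at all, gets the value 0. *)
Definition vc_dim (T : finType) (F : {set {set T}}) : nat :=
  \max_(S : {set T} | shattered F S) #|S|.

Definition uniform (T : finType) (k : nat) (E : {set {set T}}) : bool :=
  [forall e in E, #|e| == k].

Definition nbhd (T : finType) (E : {set {set T}}) (S : {set T}) : {set T} :=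
  [set v | S :|: [set v] \in E].

Definition hvc_dim (T : finType) (k : nat) (E : {set {set T}}) : nat :=
  vc_dim [set nbhd E S | S : {set T} & #|S| == k.-1].

Definition clique (T : finType) (k : nat) (E : {set {set T}}) (W : {set T}) :
  bool := [forall e : {set T}, (e \subset W) && (#|e| == k) ==> (e \in E)].

Definition stable_set (T : finType) (k : nat) (E : {set {set T}})
    (W : {set T}) : bool :=
  [forall e : {set T}, (e \subset W) && (#|e| == k) ==> (e \notin E)].

Definition vc_ramsey_prop (k d n m : nat) : Prop :=
  forall (T : finType) (E : {set {set T}}),
    #|T| = m -> uniform k E -> hvc_dim k E <= d ->
    exists W : {set T}, (clique k E W || stable_set k E W) && (n <= #|W|).

(* [is_vc_ramsey k d n m] says that the number R_k^d(n) exists and equals m. *)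
Definition is_vc_ramsey (k d n m : nat) : Prop :=
  [/\ 1 <= m, vc_ramsey_prop k d n m
    & forall m' : nat, 1 <= m' -> vc_ramsey_prop k d n m' -> m <= m'].

(* Meaningful for k >= 1; the index 0 gets the same junk value as index 1. *)
Fixpoint twr (R : realType) (k : nat) (t : R) : R :=
  match k with
  | 0 | 1 => t
  | k'.+1 => powR 2%R (twr k' t)
  end.

(* Main.v *)
Require Import Defs.
From mathcomp Require Import all_boot all_order all_algebra.
From mathcomp Require Import boolp reals exp zify.

(** The base case k = 2 is the polynomial Erdos-Hajnal property of graphs of
    bounded VC-dimension, proved by induction on the dimension.  By packing
    (Haussler), a large vertex set S contains many equal-sized blobs whose
    vertices have nearly the same neighbourhood in S, and between most pairs of
    blobs one colour is overwhelming; trimming yields a representative z_i in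
    each blob D_i that sees, from the other blobs, only the majority colour.
    If a vertex v has both colours towards D_i, then replacing z_i by a
    neighbour or a non-neighbour of v in D_i extends any pattern shattered
    among such z_i by one more coordinate; so these z_i have smaller dimension
    and contain a large homogeneous set, whose blobs form a set in which one
    colour is much rarer than in S.  If no vertex is mixed to many blobs, an
    averaging argument gives many large pieces of blobs, pairwise joined in a
    single colour, and the product of the largest clique and the largest stable
    set is superadditive along such a blockade.  Iterating the first outcome
    with a squared parameter each time ends in a homogeneous set.

    The step from k to k + 1 is that of Erdos and Rado: one finds w and a large
    L such that each (k+1)-set f in L contains a k-set g with f and w |: g both
    edges or both non-edges; the link of w on L is a k-uniform hypergraph of no
    larger VC-dimension, and its homogeneous sets are homogeneous. *)

Set Implicit Arguments.
Unset Strict Implicit.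
Unset Printing Implicit Defensive.

(** * Averaging over vertices and over subsets *)

Section Averaging.
Variable T : finType.
Implicit Types (A B : {set T}) (f : T -> nat) (g : T -> T -> nat).

Lemma ex_leq_avg A f : 0 < #|A| ->
  exists2 x, x \in A & f x * #|A| <= \sum_(y in A) f y.
Proof.
case/card_gt0P=> x0 x0A; case: (arg_minnP f x0A) => x xA xmin.
exists x => //; rewrite mulnC -sum_nat_const; exact: leq_sum.
Qed.

Lemma ex_geq_avg A f : 0 < #|A| ->
  exists2 x, x \in A & \sum_(y in A) f y <= f x * #|A|.
Proof.
case/card_gt0P=> x0 x0A; case: (arg_maxnP f x0A) => x xA xmax.
exists x => //; rewrite mulnC -sum_nat_const; exact: leq_sum.
Qed.

Definition pairsum g A := \sum_(i in A) \sum_(j in A | j != i) g i j.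

Lemma pairsum_setD1 g A x : x \in A ->
  pairsum g A = pairsum g (A :\ x) +
    (\sum_(j in A | j != x) g x j + \sum_(i in A | i != x) g i x).
Proof.
move=> xA; rewrite /pairsum (bigD1 x) //= addnCA; congr (_ + _).
rewrite (eq_bigr (fun i => \sum_(j in A :\ x | j != i) g i j + g i x)); last first.
  move=> i /andP[iA ix]; rewrite (bigD1 x) /=; last by rewrite xA eq_sym.
  rewrite addnC; congr (_ + _); apply: eq_bigl => j; rewrite !inE.
  by do !case: (_ == _) => //=; rewrite ?andbT ?andbF.
rewrite big_split /=; congr (_ + _).
by apply: eq_bigl => i; rewrite !inE andbC.
Qed.

(** Double counting: an ordered pair survives the deletion of every element except its own two. *)
Lemma sum_pairsum_setD1 g A :
  \sum_(x in A) pairsum g (A :\ x) + 2 * pairsum g A = #|A| * pairsum g A.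
Proof.
rewrite -sum_nat_const (eq_bigr _ (fun x => @pairsum_setD1 g A x)) !big_split /=.
congr (_ + _); rewrite mul2n -addnn; congr (_ + _).
rewrite (exchange_big_dep (mem A)) /=; last by move=> i j _ /andP[].
by apply: eq_bigr => i iA; apply: eq_bigl => j; rewrite iA /= eq_sym.
Qed.

(** Delete one element at a time, always one whose deletion leaves the least sum. From size [a] the
    average remaining sum is a fraction [(a - 2) / a] of the old one, which is at most
    [((a - 1) / a) ^ 2], so the density never grows. *)
Lemma pairsum_avg g A m : 1 <= m <= #|A| ->
  exists B : {set T}, [/\ B \subset A, #|B| = m &
    pairsum g B * #|A| ^ 2 <= pairsum g A * m ^ 2].
Proof.
case/andP=> m1; move eqa: (#|A| - m) => k.
elim: k A eqa => [|k IH] A eqa mA.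
  by exists A; split => //; have -> : #|A| = m by lia.
have A0 : 0 < #|A| by lia.
have [x xA xle] := ex_leq_avg (fun x => pairsum g (A :\ x)) A0.
have := sum_pairsum_setD1 g A; have := cardsD1 x A; rewrite xA.
set a := #|A|; set a' := #|_ :\ _| => ea es.
have [||B [BA Bm Ble]] := IH (A :\ x); rewrite -/a' -?/a; try lia.
exists B; split => //; first exact: subset_trans BA (subsetDl _ _).
move: Ble xle es; rewrite -/a -/a' ea /=; set p := pairsum g B.
set p' := pairsum _ (_ :\ _); set p0 := pairsum g A; set s := \sum_(_ in _) _.
move=> h1 h2 h3.
have a'0 : 0 < a' by lia.
rewrite -(leq_pmul2r (_ : 0 < a' ^ 2)) ?expn_gt0 ?a'0 //.
have h4 : p' * (1 + a') ^ 2 <= p0 * a' ^ 2.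
  have: p' * (1 + a') + 2 * p0 <= (1 + a') * p0 by lia.
  nia.
have : (p * a' ^ 2) * (1 + a') ^ 2 <= (p' * m ^ 2) * (1 + a') ^ 2 by rewrite leq_mul2r h1 orbT.
have : (p' * (1 + a') ^ 2) * m ^ 2 <= p0 * a' ^ 2 * m ^ 2 by rewrite leq_mul2r h4 orbT.
lia.
Qed.

End Averaging.

(* Pajor's lemma, from which Sauer's bound follows. *)
Lemma card_shattered_ge (T : finType) (F : {set {set T}}) :
  #|F| <= #|[set X | shattered F X]|.
Proof.
move: {2}#|F| (leqnn #|F|) => n; elim: n F => [|n IH] F Fn.
  by move: Fn; rewrite leqn0 => /eqP->.
have [F1|F1] := leqP #|F| 1.
  have [->|/set0Pn[B BF]] := eqVneq F set0; first by rewrite cards0.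
  apply: leq_trans F1 _; apply/card_gt0P; exists set0; rewrite inE.
  apply/forallP=> A; apply/implyP; rewrite subset0 => /eqP->.
  by apply/existsP; exists B; rewrite BF setI0 eqxx.
have [B1 [B2 [B1F B2F B12]]] : exists B1 B2, [/\ B1 \in F, B2 \in F & B1 != B2].
  by case/card_gt1P: F1 => B1 [B2 [? ? ?]]; exists B1, B2.
have [x xB] : exists x, (x \in B1) != (x \in B2).
  apply/existsP; apply: contraR B12; rewrite negb_exists => /forallP h.
  by apply/eqP/setP=> x; apply/eqP; rewrite -[_ == _]negbK.
(* Split [F] by membership of [x]; both halves are nonempty, hence smaller than [F]. A set shattered
   by both is counted twice, and the second count is paid by its extension by [x] in [Sx]. *)
pose G (b : bool) := [set B in F | (x \in B) == b].
have GF b : G b \subset F by apply/subsetP=> B; rewrite inE => /andP[].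
have card_G : #|F| = #|G true| + #|G false|.
  rewrite -(cardsID (G true) F) (setIidPr (GF true)); congr (_ + _).
  apply: eq_card => B; rewrite !inE; by case: (B \in F); case: (x \in B).
have G0 b : 0 < #|G b|.
  apply/card_gt0P; case: (eqVneq (x \in B1) b) => hb.
    by exists B1; rewrite inE B1F hb eqxx.
  exists B2; rewrite inE B2F; by move: xB hb; case: (x \in B1); case: (x \in B2); case: b.
have IHb b : #|G b| <= #|[set X | shattered (G b) X]|.
  by apply: IH; move: (G0 true) (G0 false); case: b; lia.
pose Sh b := [set X | shattered (G b) X].
have xSh b X : X \in Sh b -> x \notin X.
  rewrite inE => /forallP sX; apply/negP=> xX.
  have : (if b then X :\ x else X) \subset X by case: b sX => // _; rewrite subsetDl.
  move/(implyP (sX _))/existsP=> [B]; rewrite inE => /andP[/andP[_ xb] /eqP e].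
  have := congr1 (fun A : {set T} => x \in A) e.
  by rewrite inE xX (eqP xb) andbT; case: b {sX e xb}; rewrite ?inE ?eqxx ?xX.
have ShF b X : X \in Sh b -> shattered F X.
  rewrite inE => /forallP sX; apply/forallP=> A; apply/implyP=> /(implyP (sX A)).
  case/existsP=> B /andP[BG BA]; apply/existsP; exists B.
  by rewrite BA (subsetP (GF b)).
pose Sx := (fun X => x |: X) @: (Sh true :&: Sh false).
have cSx : #|Sx| = #|Sh true :&: Sh false|.
  apply: card_in_imset => X Y /setIP[/xSh xX _] /setIP[/xSh xY _] e.
  by rewrite -(setU1K xX) e setU1K.
have SxF X : X \in Sx -> shattered F X.
  case/imsetP=> Z /setIP[Zt Zf] ->; apply/forallP=> A; apply/implyP=> AZ.
  have xZ := xSh _ _ Zt.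
  have Zb : Z \in Sh (x \in A) by case: (x \in A).
  have AxZ : A :\ x \subset Z.
    by apply/subsetP=> y; rewrite !inE => /andP[yx /(subsetP AZ)]; rewrite !inE (negPf yx).
  move: Zb; rewrite inE => /forallP/(_ (A :\ x)); rewrite AxZ => /existsP[B].
  rewrite inE => /andP[/andP[BF xB'] /eqP e]; apply/existsP; exists B; rewrite BF /=.
  apply/eqP/setP=> y; have := congr1 (fun A : {set T} => y \in A) e.
  rewrite !inE; case: (eqVneq y x) => [->|yx] /=; first by rewrite (eqP xB') andbT.
  by [].
have dis : [disjoint (Sh true :|: Sh false) & Sx].
  rewrite -setI_eq0; apply/eqP/setP=> X; rewrite in_set0; apply/negbTE/negP.
  case/setIP=> hX /imsetP[Z _ eX]; have : x \notin X by case/setUP: hX => /xSh.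
  by rewrite eX setU11.
apply: leq_trans (_ : #|(Sh true :|: Sh false) :|: Sx| <= _).
  have := cardsUI (Sh true :|: Sh false) Sx.
  have := cardsUI (Sh true) (Sh false).
  rewrite (disjoint_setI0 dis) cards0 cSx card_G; have := IHb true; have := IHb false.
  rewrite -!/(Sh _); lia.
apply: subset_leq_card; apply/subsetP=> X hX; rewrite inE.
by case/setUP: hX => [/setUP[]|] => [/ShF|/ShF|/SxF].
Qed.

(** * Numerical estimates for Sauer's bound and for packing *)

Lemma leq_expl m n e : m <= n -> m ^ e <= n ^ e.
Proof. by case: e => // e; rewrite leq_exp2r. Qed.

Lemma bin_leq_exp n m : 'C(n, m) <= n ^ m.
Proof.
apply: (@leq_trans (n ^_ m)); first by rewrite -bin_ffact leq_pmulr ?fact_gt0.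
elim: m n => [|m IH] n; first by rewrite ffactn0.
case: n => [|n]; first by rewrite ffact0n.
rewrite ffactnS expnS leq_mul2l; apply: leq_trans (IH _) _.
by apply: leq_expl; rewrite leq_pred.
Qed.

Lemma card_small_subsets (T : finType) (Y : {set T}) d :
  #|[set X : {set T} | (X \subset Y) && (#|X| < d)]| <= #|Y|.+1 ^ d.
Proof.
case: (posnP #|Y|) => [Y0|Y0].
  rewrite Y0 exp1n -(cards1 (set0 : {set T})); apply: subset_leq_card.
  by apply/subsetP=> X; rewrite !inE (cards0_eq Y0) subset0 => /andP[].
elim: d => [|d IH].
  by rewrite (_ : [set _ | _] = set0) ?cards0 //; apply/setP=> X; rewrite !inE ltn0 andbF.
apply: (@leq_trans (#|Y|.+1 ^ d + #|Y| ^ d)); last first.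
  rewrite expnS mulSn leq_add2l.
  by rewrite -[X in X <= _]mul1n leq_mul // leq_expl.
apply: (@leq_trans (#|[set X : {set T} | (X \subset Y) && (#|X| < d)]| +
                     #|[set X : {set T} | (X \subset Y) & (#|X| == d)]|)); last first.
  by rewrite leq_add // cards_draws bin_leq_exp.
apply: leq_trans (leq_card_setU _ _).
apply: subset_leq_card; apply/subsetP=> X; rewrite !inE ltnS leq_eqVlt => /andP[->] /=.
by rewrite orbC.
Qed.

(** Bernoulli's inequality for [(1 + 1/x) ^ n], with denominators cleared. *)
Lemma bernoulli_nat x n : (x + n) * x ^ n <= x * x.+1 ^ n.
Proof.
elim: n => [|n IH]; first by rewrite addn0.
have: (x + n) * x ^ n * x.+1 <= x * x.+1 ^ n * x.+1 by rewrite leq_mul2r IH orbT.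
rewrite !expnS; nia.
Qed.

Lemma double_exp_pred s : 0 < s -> s.-1 ^ s * 2 <= s ^ s.
Proof.
case: s => // x _ /=; case: (posnP x) => [->|x0]; first by [].
have := bernoulli_nat x x.+1; rewrite -(leq_pmul2l x0); nia.
Qed.

(** Since [(1 - 1/s) ^ s] is at most 1/2, this many rounds of greedy separation bring [2 ^ (2 * l)]
    pairs below one. *)
Lemma exp_pred_lt s l : 0 < s -> s.-1 ^ (s * (2 * l).+1) * 2 ^ (2 * l) < s ^ (s * (2 * l).+1).
Proof.
move=> s0; rewrite !(expnM s) !(expnM s.-1).
have h := leq_expl (2 * l).+1 (double_exp_pred s0).
rewrite expnMn (expnS 2 (2 * l)) in h.
have : 0 < (s ^ s) ^ (2 * l).+1 by rewrite !expn_gt0 s0.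
move: h; set a := (s.-1 ^ s) ^ _; set b := _ ^ (2 * l).+1; set c := 2 ^ _; nia.
Qed.

(** * Shattering and packing in graphs *)

Section Graph.
Variables (T : finType) (e : rel T).
Implicit Types (S P W Y Q : {set T}) (b : bool).

Definition homog b W := [forall x in W, forall y in W, (x != y) ==> (e x y == b)].

Lemma homogP b W :
  reflect (forall x y, x \in W -> y \in W -> x != y -> e x y = b) (homog b W).
Proof.
apply: (iffP forall_inP) => [h x y xW yW xy|h x xW].
  by have /forall_inP/(_ y yW) := h x xW; rewrite xy => /eqP.
by apply/forall_inP=> y yW; apply/implyP=> xy; rewrite h.
Qed.

Definition num_colored b S := pairsum (fun x y => (e x y == b) : nat) S.

(** Some [k]-subset is no denser in colour [b] than [S]; its number of [b]-pairs is at most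
    [k ^ 2 / y], below one, hence zero. *)
Lemma homog_of_num_colored b S k y : 1 <= k <= #|S| -> num_colored b S * y <= #|S| ^ 2 ->
  k ^ 2 < y -> exists W, [/\ W \subset S, homog (~~ b) W & #|W| = k].
Proof.
move=> kS Sy ky; have [W [WS Wk Wle]] := pairsum_avg (fun x y => (e x y == b) : nat) kS.
exists W; split=> //; have S0 : 0 < #|S| ^ 2 by rewrite expn_gt0; lia.
have : pairsum (fun x y => (e x y == b) : nat) W * y <= k ^ 2.
  rewrite -(leq_pmul2r S0) mulnAC; apply: leq_trans (leq_mul Wle (leqnn y)) _.
  by rewrite mulnAC [k ^ 2 * _]mulnC leq_mul2r Sy orbT.
set p := pairsum _ _ => h.
have /eqP : p = 0 by case: (posnP p) => // p0; nia.
rewrite sum_nat_eq0 => /forall_inP p0; apply/homogP=> x z xW zW xz.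
have := p0 x xW; rewrite sum_nat_eq0 => /forall_inP/(_ z); rewrite zW eq_sym xz => /(_ isT).
by rewrite eqb0; case: (e x z); case: b {Sy Wle p h p0}.
Qed.

(* The bipartite form of VC-dimension at least d; the value of e on the
   diagonal is irrelevant throughout, hence the condition p I != x i. *)
Definition bishattered d S := exists (x : 'I_d -> T) (p : {set 'I_d} -> T),
  [/\ forall i, x i \in S, forall I, p I \in S, forall I i, p I != x i
    & forall I i, e (x i) (p I) = (i \in I)].

Hypothesis esym : symmetric e.

(** Sauer's bound: the vertices of [P] have distinct traces on [Y], and [d] points shattered by the
    traces would be bishattered, disjointness of [P] and [Y] giving [p I != x i]. So all shattered
    sets have fewer than [d] elements. *)
Lemma card_traces_le d S P Y : ~ bishattered d S -> Y \subset S -> P \subset S ->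
  [disjoint P & Y] ->
  {in P &, forall p p', (forall y, y \in Y -> e p y = e p' y) -> p = p'} ->
  #|P| <= #|Y|.+1 ^ d.
Proof.
move=> nsh YS PS dPY inj; pose tr p := [set y in Y | e p y].
have <- : #|tr @: P| = #|P|.
  apply: card_in_imset => p p' pP p'P /setP h; apply: inj => // y yY.
  by have := h y; rewrite !inE yY.
apply: leq_trans (card_shattered_ge _) _; apply: leq_trans (card_small_subsets Y d).
apply: subset_leq_card; apply/subsetP=> X; rewrite !inE => /forallP shX.
have XY : X \subset Y.
  have /existsP[B /andP[/imsetP[p _ ->] /eqP <-]] := implyP (shX X) (subxx X).
  by apply/subsetP=> y; rewrite !inE => /andP[/andP[]].
rewrite XY ltnNge; apply/negP=> dX; apply: nsh.
pose x (i : 'I_d) := enum_val (widen_ord dX i).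
have xX i : x i \in X by apply: enum_valP.
have xinj : injective x by move=> i j /enum_val_inj h; apply/val_inj; have := congr1 val h.
have hp (I : {set 'I_d}) : exists p, (p \in P) && (tr p :&: X == x @: I).
  have xIX : x @: I \subset X by apply/subsetP=> _ /imsetP[i _ ->].
  have /existsP[B /andP[/imsetP[p pP ->] pI]] := implyP (shX _) xIX.
  by exists p; rewrite pP pI.
exists x, (fun I => xchoose (hp I)); split=> [i|I|I i|I i].
- exact: subsetP YS _ (subsetP XY _ (xX i)).
- by have /andP[/(subsetP PS)] := xchooseP (hp I).
- have /andP[pP _] := xchooseP (hp I); apply/eqP=> h.
  have := disjoint_setI0 dPY => /setP/(_ (x i)).
  by rewrite !inE -{1}h pP (subsetP XY).
have /andP[pP /eqP/setP/(_ (x i))] := xchooseP (hp I).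
by rewrite mem_imset // !inE (subsetP XY _ (xX i)) xX andbT /= esym.
Qed.

Definition dist S p p' := #|[set q in S | e p q != e p' q]|.

Definition unsep Q Y := [set pq : T * T | [&& pq.1 \in Q, pq.2 \in Q, pq.1 != pq.2
  & [forall y in Y, e pq.1 y == e pq.2 y]]].

(** Each pair from [Q] is separated by a fraction [1/s] of [S], so by averaging some vertex of [S]
    separates at least [1/s] of the pairs that are still unseparated. Add it to [Y] and repeat. *)
Lemma greedy_separation S Q s m : 0 < s -> Q \subset S ->
  {in Q &, forall p p', p != p' -> #|S| <= s * dist S p p'} ->
  exists Y, [/\ Y \subset S, #|Y| <= m & #|unsep Q Y| * s ^ m <= #|Q| ^ 2 * s.-1 ^ m].
Proof.
move=> s0 QS sepQ; elim: m => [|m [Y [YS Ym Yle]]].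
  exists set0; rewrite sub0set cards0; split => //.
  rewrite !expn0 !muln1 -mulnn -cardsX; apply: subset_leq_card.
  by apply/subsetP=> -[p p']; rewrite !inE => /and3P[-> ->].
have [S0|S0] := posnP #|S|.
  exists set0; rewrite sub0set cards0; split => //.
  have -> : unsep Q set0 = set0; last by rewrite cards0.
  apply/setP=> -[p p']; rewrite !inE /=; case: (boolP (p \in Q)) => //.
  by move/(subsetP QS); rewrite (cards0_eq S0) inE.
pose sepby q := [set pq in unsep Q Y | e pq.1 q != e pq.2 q].
have [q qS qge] := ex_geq_avg (fun q => #|sepby q|) S0.
have tot : #|unsep Q Y| * #|S| <= s * \sum_(q in S) #|sepby q|.
  under [X in _ <= s * X]eq_bigr => q' _ do rewrite -sum1_card.
  rewrite (exchange_big_dep (mem (unsep Q Y))) /=; last by move=> q' pq _; rewrite inE => /andP[].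
  rewrite big_distrr /= -sum_nat_const; apply: leq_sum => -[p p'] hU.
  move: (hU); rewrite inE /= => /and4P[pQ p'Q pp' _].
  apply: leq_trans (sepQ _ _ pQ p'Q pp') _; rewrite leq_mul2l; apply/orP; right.
  rewrite sum1dep_card; apply: subset_leq_card; apply/subsetP=> q'.
  by rewrite inE [in X in _ -> X]inE inE hU /=.
exists (q |: Y); split; first by rewrite subUset sub1set qS.
  by rewrite cardsU1; case: (q \notin Y) => /=; lia.
have eU : #|unsep Q Y| = #|unsep Q (q |: Y)| + #|sepby q|.
  rewrite -(cardsID (unsep Q (q |: Y)) (unsep Q Y)); congr (_ + _).
    apply: eq_card => -[p p']; rewrite !inE /=.
    case: (p \in Q) => //=; case: (p' \in Q) => //=; case: (p != p') => //=.
    apply/andP/idP => [[]//|h]; split=> //; apply/forall_inP=> y yY.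
    by apply: (forall_inP h); rewrite setU1r.
  apply: eq_card => -[p p']; rewrite !inE /=.
  case: (p \in Q) => //=; case: (p' \in Q) => //=; case: (p != p') => //=.
  case: (boolP [forall y in Y, _]) => h; rewrite ?andbF // andbT /=.
  congr (~~ _); apply/forall_inP/idP => [-> //|hq y]; first exact: setU11.
  by case/setU1P=> [->//|]; apply: (forall_inP h).
have : #|unsep Q Y| <= s * #|sepby q|.
  rewrite -(leq_pmul2r S0); apply: leq_trans tot _; rewrite -mulnA leq_mul2l qge orbT //.
move=> hs; have h2 : #|unsep Q (q |: Y)| * s <= #|unsep Q Y| * s.-1.
  move: hs; rewrite eU; case: (s) s0 => // s' _ /=; set a := #|_|; set b := #|_|.
  rewrite !mulSn => hs; have: a <= s' * b by lia.
  by rewrite mulnDl [b * _]mulnC mulnS [a * _]mulnC; lia.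
rewrite (expnS s) (expnS s.-1); move: h2 Yle; set a := #|_|; set c := #|_|; set qq := #|Q| ^ 2.
move=> h2 h3; apply: (@leq_trans (c * s.-1 * s ^ m)); first by rewrite mulnA leq_mul2r h2 orbT.
have: c * s ^ m * s.-1 <= qq * s.-1 ^ m * s.-1 by rewrite leq_mul2r h3 orbT.
by move=> h4; rewrite mulnAC [s.-1 * _]mulnC mulnA.
Qed.

(** After [m] greedy choices less than one pair is left unseparated. Sauer's bound then applies to
    [Q :\: Y], while [Q :&: Y] has at most [m] elements. *)
Lemma packing S Q d s m : 0 < s -> ~ bishattered d S -> Q \subset S ->
  {in Q &, forall p p', p != p' -> #|S| <= s * dist S p p'} ->
  #|Q| ^ 2 * s.-1 ^ m < s ^ m -> #|Q| <= m.+1 ^ d.+1.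
Proof.
move=> s0 nsh QS sepQ hm; have [Y [YS Ym Yle]] := greedy_separation m s0 QS sepQ.
have U0 : #|unsep Q Y| = 0.
  case: (posnP #|unsep Q Y|) => // U0; suff: s ^ m <= #|Q| ^ 2 * s.-1 ^ m by lia.
  by apply: leq_trans Yle; rewrite leq_pmull.
have : #|Q :\: Y| <= #|Y|.+1 ^ d.
  apply: (card_traces_le nsh YS (subset_trans (subsetDl _ _) QS)).
    by rewrite -setI_eq0 setIC setIDA setDIl setDv set0I.
  move=> p p' /setDP[pQ _] /setDP[p'Q _] h; apply/eqP; apply/negPn/negP=> pp'.
  have := cards0_eq U0 => /setP/(_ (p, p')); rewrite !inE pQ p'Q pp' /=.
  by move/negbT/negP; apply; apply/forall_inP=> y yY; rewrite h.
have := cardsID Y Q; have := subset_leq_card (subsetIr Q Y).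
have : #|Y|.+1 ^ d <= m.+1 ^ d by apply: leq_expl.
have : 0 < m.+1 ^ d by rewrite expn_gt0.
rewrite expnS; set a := m.+1 ^ d; set b := #|Y|.+1 ^ d; nia.
Qed.
End Graph.

(** * Cutting a set into equal blobs of nearby vertices *)

Lemma ex_subset_card (T : finType) (A : {set T}) k : k <= #|A| ->
  exists2 B : {set T}, B \subset A & #|B| = k.
Proof.
rewrite -bin_gt0 -cards_draws => /card_gt0P[B]; rewrite inE => /andP[BA /eqP Bk].
by exists B.
Qed.

Lemma leq_card_bigcup (I T : finType) (J : {set I}) (A : I -> {set T}) :
  #|\bigcup_(i in J) A i| <= \sum_(i in J) #|A i|.
Proof.
elim/big_rec2: _ => [|i n X _ h]; first by rewrite cards0.
by apply: leq_trans (leq_card_setU _ _) _; rewrite leq_add2l.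
Qed.

(** The number of separating vertices is below [2 ^ ((d + 12) * sg)]; the packing bound raises it to
    the power [d.+1], and the final 1 makes the comparison strict. *)
Definition packexp d := (d + 12) * d.+1 + 1.

Lemma packexp_gt0 d : 0 < packexp d. Proof. by rewrite /packexp addn1. Qed.

Lemma packexp_bound d : 2 * packexp d + 2 <= 2 ^ (d + 10).
Proof.
rewrite /packexp; elim: d => [|d IH]; first by [].
have h : 2 ^ (d.+1 + 10) = 2 * 2 ^ (d + 10) by rewrite addSn expnS.
rewrite h; move: IH; set z := 2 ^ _; nia.
Qed.

Section Pieces.
Variables (T : finType) (e : rel T).
Hypothesis esym : symmetric e.
Implicit Types (S P W Y Q A B : {set T}) (b : bool) (F : {set {set T}}).

(* If Q had 2^l elements with l = packexp d * sg, then about 2^sg * 2l greedily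
   chosen vertices would separate it, against Sauer's bound. *)
Lemma packing_pow2 d sg S Q : 0 < sg -> ~ bishattered e d S -> Q \subset S ->
  {in Q &, forall p p', p != p' -> #|S| <= 2 ^ sg * dist e S p p'} ->
  #|Q| < 2 ^ (packexp d * sg).
Proof.
move=> sg0 nsh QS sepQ; rewrite ltnNge; apply/negP=> hl.
set l := packexp d * sg in hl; set s := 2 ^ sg in sepQ.
have s0 : 0 < s by rewrite expn_gt0.
have [Q' Q'Q Q'l] := ex_subset_card hl.
have sQ' := subsetP Q'Q.
have := @packing _ _ esym S Q' d s (s * (2 * l).+1) s0 nsh (subset_trans Q'Q QS).
rewrite Q'l -expnM [l * 2]mulnC [2 ^ _ * _]mulnC => /(_ _ (exp_pred_lt l s0)).
case/(_ _)/Wrap=> [p p' pQ p'Q|]; first by apply: sepQ; apply: sQ'.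
apply/negP; rewrite -ltnNge; have l0 : 0 < l by rewrite muln_gt0 packexp_gt0.
have h1 : (s * (2 * l).+1).+1 <= 2 ^ ((d + 12) * sg).
  have -> : (d + 12) * sg = sg + (sg + sg * (d + 10)) by lia.
  rewrite !expnD -/s.
  have h2 : 2 * l + 2 <= s * 2 ^ (sg * (d + 10)).
    apply: (@leq_trans (sg * (2 * packexp d + 2))); first by rewrite /l; nia.
    apply: leq_mul; first exact: ltnW (ltn_expl _ _).
    apply: leq_trans (packexp_bound d) _; rewrite leq_exp2l //; nia.
  apply: (@leq_trans (s * (2 * l + 2))); first by nia.
  by rewrite leq_mul2l h2 orbT.
apply: leq_ltn_trans (leq_expl d.+1 h1) _.
by rewrite -expnM ltn_exp2l // /l /packexp; nia.
Qed.

Lemma dist_sym S p q : dist e S p q = dist e S q p.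
Proof. by apply: eq_card => x; rewrite !inE eq_sym. Qed.

Lemma dist_triangle S p q r : dist e S p r <= dist e S p q + dist e S q r.
Proof.
apply: leq_trans (leq_card_setU _ _); apply: subset_leq_card; apply/subsetP=> x.
by rewrite !inE => /andP[-> /=]; case: (e p x); case: (e q x); case: (e r x).
Qed.

(** The centres form a maximal separated set: a vertex far from all of them could be added. *)
Lemma ex_centers d sg S : 0 < sg -> ~ bishattered e d S ->
  exists Q, [/\ Q \subset S, #|Q| < 2 ^ (packexp d * sg) &
    forall p, p \in S -> exists2 c, c \in Q & 2 ^ sg * dist e S p c <= #|S|].
Proof.
move=> sg0 nsh; set s := 2 ^ sg.
pose sep Q := (Q \subset S) && [forall p in Q, forall p' in Q,
   (p != p') ==> (#|S| <= s * dist e S p p')].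
have sep0 : sep set0 by rewrite /sep sub0set; apply/forall_inP=> p; rewrite inE.
have [Q Qmax _] := maxset_exists sep0.
have /andP[QS /forall_inP Qs] := maxsetp Qmax.
exists Q; split=> //.
  apply: (packing_pow2 sg0 nsh QS) => p p' pQ p'Q pp'.
  by have /forall_inP/(_ _ p'Q) := Qs p pQ; rewrite pp'.
move=> p pS; case: (boolP [exists c in Q, s * dist e S p c <= #|S|]).
  by case/exists_inP=> c cQ hc; exists c.
rewrite negb_exists_in => /forall_inP h.
have : sep (p |: Q).
  rewrite /sep subUset sub1set pS QS /=.
  apply/forall_inP=> x xQ; apply/forall_inP=> y yQ; apply/implyP.
  case/setU1P: xQ => [->|xQ]; case/setU1P: yQ => [->|yQ]; rewrite ?eqxx // => xy.
  - by have := h y yQ; rewrite -ltnNge => /ltnW.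
  - by have := h x xQ; rewrite -ltnNge dist_sym => /ltnW.
  by have /forall_inP/(_ _ yQ) := Qs x xQ; rewrite xy.
move=> /(maxsetsup Qmax)/(_ (subsetUr _ _)) hQ; have pQ : p \in Q by rewrite -hQ setU11.
have := h p pQ; rewrite (_ : dist e S p p = 0) ?muln0 //.
by apply: eq_card0 => x; rewrite !inE eqxx andbF.
Qed.

(** Take a maximal family of disjoint [t]-sets, each inside the ball of one centre. Every ball then
    has fewer than [t] uncovered vertices, and [t] is so small that this leaves at most half of [S]
    uncovered. The triangle inequality through the centre doubles the radius. *)
Lemma ex_pieces d sg S (t := #|S| %/ (2 * 2 ^ (packexp d * sg))) :
  0 < sg -> ~ bishattered e d S -> 0 < t ->
  exists F, [/\ trivIset F,
    forall A, A \in F -> [/\ A \subset S, #|A| = t &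
      {in A &, forall p p', 2 ^ sg * dist e S p p' <= 2 * #|S|}],
    #|F| * t <= #|S| & #|S| <= 2 * #|F| * t].
Proof.
move=> sg0 nsh t0; have [Q [QS Ql Qc]] := ex_centers sg0 nsh.
set s := 2 ^ sg; set l := 2 ^ (packexp d * sg) in Ql *.
pose Cl c := [set p in S | s * dist e S p c <= #|S|].
pose good F := trivIset F && [forall A in F, [&& A \subset S, #|A| == t &
  [exists c in Q, A \subset Cl c]]].
have good0 : good set0.
  by apply/andP; split; [apply/trivIsetP=> A B; rewrite inE|apply/forall_inP=> A; rewrite inE].
have [F Fmax _] := maxset_exists good0.
have /andP[Ftriv /forall_inP Fg] := maxsetp Fmax.
have Fcov : #|cover F| = #|F| * t.
  rewrite -(eqP Ftriv) -sum_nat_const; apply: eq_bigr => A /Fg /and3P[_ /eqP //].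
exists F; split=> //.
- move=> A /Fg /and3P[AS /eqP At /exists_inP[c cQ /subsetP Ac]]; split=> // p p' /Ac pc /Ac p'c.
  move: pc p'c; rewrite !inE => /andP[_ h1] /andP[_ h2].
  have := dist_triangle S p c p'; rewrite (dist_sym S c) => h3.
  have : s * dist e S p p' <= s * (dist e S p c + dist e S p' c) by rewrite leq_mul2l h3 orbT.
  by rewrite mulnDr; lia.
- rewrite -Fcov; apply: subset_leq_card; apply/bigcupsP=> A /Fg.
  by case/and3P.
have unc c : c \in Q -> #|(S :\: cover F) :&: Cl c| < t.
  move=> cQ; rewrite ltnNge; apply/negP=> /ex_subset_card[A AU At].
  have AF B : B \in F -> [disjoint A & B].
    move=> BF; rewrite -setI_eq0 -subset0; apply/subsetP=> x /setIP[/(subsetP AU)].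
    rewrite !inE => /andP[/andP[xn _] _] xB; case/negP: xn.
    by apply/bigcupP; exists B.
  have F0 : set0 \notin F.
    by apply/negP=> /Fg/and3P[_]; rewrite cards0 => /eqP h; rewrite -h in t0.
  have [tAF AnF] := trivIsetU1 AF Ftriv F0.
  have : good (A |: F).
    rewrite /good tAF; apply/forall_inP=> B /setU1P[->|/Fg //].
    rewrite At eqxx /=; apply/andP; split.
      exact: subset_trans AU (subset_trans (subsetIl _ _) (subsetDl _ _)).
    by apply/exists_inP; exists c => //; apply: subset_trans AU (subsetIr _ _).
  move=> /(maxsetsup Fmax)/(_ (subsetUr _ _)) hF; move: AnF.
  by rewrite -hF setU11.
have : #|S :\: cover F| <= #|Q| * t.
  apply: (@leq_trans (\sum_(c in Q) #|(S :\: cover F) :&: Cl c|)); last first.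
    by rewrite -sum_nat_const; apply: leq_sum => c /unc /ltnW.
  apply: leq_trans (leq_card_bigcup _ _); apply: subset_leq_card; apply/subsetP=> x xU.
  have /Qc[c cQ hc] : x \in S by case/setDP: xU.
  by apply/bigcupP; exists c => //; rewrite inE xU inE hc andbT; case/setDP: xU.
have := cardsID (cover F) S; have := subset_leq_card (subsetIr S (cover F)).
rewrite Fcov; have : t * (2 * l) <= #|S| by exact: leq_divM.
set c1 := #|S :\: _|; set c2 := #|S :&: _|; nia.
Qed.
End Pieces.

(** * Regular families of blobs *)

Section Regular.
Variables (T : finType) (e : rel T).
Hypothesis esym : symmetric e.
Implicit Types (S P W Y Q A B : {set T}) (b : bool) (F : {set {set T}}).

Definition cnt b A B := \sum_(p in A) \sum_(q in B) (e p q == b : nat).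
Definition disagr A B :=
  \sum_(p in A) \sum_(p' in A) \sum_(q in B) (e p q != e p' q : nat).

Lemma cnt_add A B : cnt true A B + cnt false A B = #|A| * #|B|.
Proof.
rewrite -big_split /= -sum_nat_const; apply: eq_bigr => p _.
rewrite -big_split /= -sum1_card; apply: eq_bigr => q _; by case: (e p q).
Qed.

(** If [e p q] is true and [e p' q'] false, then either [p] and [p'] disagree at [q], or [q] and
    [q'] disagree at [p']; the remaining fourth vertex is free, whence the factor [t]. *)
Lemma cnt_mul_le A B t : #|A| = t -> #|B| = t ->
  cnt true A B * cnt false A B <= t * (disagr A B + disagr B A).
Proof.
move=> At Bt; rewrite /cnt big_distrlr /=.
have step p p' : (\sum_(q in B) (e p q == true : nat)) * (\sum_(q in B) (e p' q == false : nat))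
   <= t * (\sum_(q in B) (e p q != e p' q : nat)) +
      \sum_(q in B) \sum_(q' in B) (e p' q != e p' q' : nat).
  rewrite big_distrlr /= big_distrr /= -big_split /=; apply: leq_sum => q _.
  rewrite -[t in t * _]Bt -sum_nat_const -big_split /=; apply: leq_sum => q' _.
  by case: (e p q); case: (e p' q); case: (e p' q').
apply: leq_trans (leq_sum _ (fun p _ => leq_sum _ (fun p' _ => step p p'))) _.
under eq_bigr => p _ do rewrite big_split /= -big_distrr /=.
rewrite big_split /= -big_distrr /= mulnDr leq_add2l sum_nat_const At leq_mul2l.
apply/orP; right; rewrite exchange_big /= /disagr; apply: leq_sum => q _.
rewrite exchange_big /=; apply: leq_sum => q' _; apply: leq_sum => p _.
by rewrite !(esym p).
Qed.

(** For fixed [p] and [p'] in a piece [A], the disagreements over all pieces [B] are distinct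
    vertices of [S], so [dist e S p p'] bounds their number. *)
Lemma sum_disagr_le F S t n s : trivIset F ->
  (forall A, A \in F -> [/\ A \subset S, #|A| = t &
     {in A &, forall p p', s * dist e S p p' <= n}]) ->
  s * (\sum_(A in F) \sum_(B in F) disagr A B) <= #|F| * (t ^ 2 * n).
Proof.
move=> tF FP; rewrite big_distrr /= -sum_nat_const; apply: leq_sum => A AF.
have [AS At Ad] := FP A AF.
rewrite /disagr exchange_big /=.
under eq_bigr => p _ do rewrite exchange_big /=.
rewrite big_distrr /= -mulnn -mulnA -{1}At -sum_nat_const; apply: leq_sum => p pA.
rewrite big_distrr /= -At -sum_nat_const; apply: leq_sum => p' p'A.
apply: leq_trans (Ad p p' pA p'A); rewrite leq_mul2l; apply/orP; right.
rewrite -(big_trivIset F (E := fun q => (e p q != e p' q : nat)) tF) /=.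
rewrite /dist -sum1dep_card big_mkcondr /=.
have cS : cover F \subset S by apply/bigcupsP=> B /FP[].
rewrite [X in _ <= X](bigID (mem (cover F))) /=.
apply: leq_trans _ (leq_addr _ _).
rewrite [X in _ <= X](eq_bigl (mem (cover F))).
  by apply: leq_sum => q _; case: (e p q != e p' q).
by move=> q /=; case: (boolP (q \in cover F)); rewrite ?andbF // => /(subsetP cS) ->.
Qed.

Lemma sum_cnt_le b F S : trivIset F -> (forall A, A \in F -> A \subset S) ->
  pairsum (cnt b) F <= num_colored e b S.
Proof.
move=> tF FS; have cS : cover F \subset S by apply/bigcupsP.
pose G p q := (e p q == b : nat).
apply: (@leq_trans (\sum_(p in cover F) \sum_(q in S | q != p) G p q)); last first.
  rewrite /num_colored /pairsum [X in _ <= X](bigID (mem (cover F))) /=.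
  apply: leq_trans _ (leq_addr _ _).
  rewrite [X in _ <= X](eq_bigl (mem (cover F))) //.
  by move=> q /=; case: (boolP (q \in cover F)); rewrite ?andbF // => /(subsetP cS) ->.
rewrite (big_trivIset _ tF) /=; apply: leq_sum => A AF.
rewrite exchange_big /=; apply: leq_sum => p pA.
apply: (@leq_trans (\sum_(q in cover (F :\ A)) G p q)).
  have tF' : trivIset (F :\ A) by apply: trivIsetS tF; apply: subsetDl.
  rewrite (big_trivIset _ tF') /= [X in _ <= X](eq_bigl (fun B => (B \in F) && (B != A))) //.
  by move=> B; rewrite !inE andbC.
have h : {subset cover (F :\ A) <= [pred q in S | q != p]}.
  move=> q /bigcupP[B]; rewrite !inE => /andP[BA BF] qB; rewrite (subsetP (FS B BF)) //=.
  apply/eqP=> qp; have /trivIsetP/(_ B A BF AF BA) := tF.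
  by move/disjoint_setI0/setP/(_ q); rewrite !inE qB qp pA.
rewrite [X in _ <= X](bigID (mem (cover (F :\ A)))) /=.
apply: leq_trans _ (leq_addr _ _).
rewrite [X in _ <= X](eq_bigl (mem (cover (F :\ A)))) //.
by move=> q /=; case: (boolP (q \in cover (F :\ A))) => hq; rewrite ?andbF // andbT; have := h q hq.
Qed.

Lemma ex_regular_pieces d sg S b y M (t := #|S| %/ (2 * 2 ^ (packexp d * sg))) :
  0 < sg -> ~ bishattered e d S -> 0 < t -> num_colored e b S * y <= #|S| ^ 2 ->
  0 < M <= 2 ^ (packexp d * sg) ->
  exists F, [/\ trivIset F, #|F| = M,
    forall A, A \in F -> A \subset S /\ #|A| = t,
    pairsum (fun A B => cnt true A B * cnt false A B) F * 2 ^ sg <= 16 * M ^ 2 * t ^ 4 &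
    pairsum (cnt b) F * y <= 8 * M ^ 2 * t ^ 2].
Proof.
move=> sg0 nsh t0 Sy /andP[M0 Ml]; have [P [Ptriv PP Pt Sle]] := ex_pieces esym sg0 nsh t0.
(* One averaging must control two sums, so they are merged into [g]; the weights [s] and
   [2 * t ^ 2 * y] bound both parts by the same [8 * #|P| ^ 2 * t ^ 4]. *)
rewrite -/t in PP Pt Sle; set s := 2 ^ sg in PP *.
pose imp A B := cnt true A B * cnt false A B.
pose g A B := imp A B * s + cnt b A B * (2 * t ^ 2 * y).
have pairsumD : forall H, pairsum g H = pairsum imp H * s + pairsum (cnt b) H * (2 * t ^ 2 * y).
  move=> H; rewrite /pairsum !big_distrl -big_split /=; apply: eq_bigr => A _.
  by rewrite !big_distrl -big_split.
have tl : t * (2 * 2 ^ (packexp d * sg)) <= #|S| by apply: leq_divM.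
have MP : 0 < M <= #|P|.
  rewrite M0 /=; apply: leq_trans Ml _.
  have := leq_trans tl Sle; rewrite mulnCA -mulnA leq_pmul2l // mulnC.
  by rewrite leq_pmul2r.
have h1 : pairsum imp P * s <= 8 * #|P| ^ 2 * t ^ 4.
  apply: (@leq_trans (2 * t * (s * \sum_(A in P) \sum_(B in P) disagr A B))).
    rewrite [s * _]mulnC mulnA leq_mul2r; apply/orP; right.
    apply: (@leq_trans (\sum_(A in P) \sum_(B in P) (t * (disagr A B + disagr B A)))).
      apply: leq_sum => A AP; rewrite big_mkcondr; apply: leq_sum => B BP.
      by case: ifP => // _; apply: cnt_mul_le; [case: (PP A AP)|case: (PP B BP)].
    under eq_bigr => A _ do rewrite -big_distrr big_split /=.
    rewrite -big_distrr big_split /= -[2 * t]mulnC -mulnA leq_mul2l; apply/orP; right.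
    by rewrite [X in _ + X]exchange_big /= mul2n addnn.
  have h := sum_disagr_le Ptriv PP.
  apply: leq_trans (leq_mul (leqnn _) h) _.
  have -> : 2 * t * (#|P| * (t ^ 2 * (2 * #|S|))) = 4 * #|P| * t ^ 3 * #|S| by lia.
  apply: leq_trans (leq_mul (leqnn _) Sle) _; lia.
have h2 : pairsum (cnt b) P * y <= 4 * #|P| ^ 2 * t ^ 2.
  apply: leq_trans (_ : num_colored e b S * y <= _).
    by rewrite leq_mul2r sum_cnt_le ?orbT // => A /PP[].
  apply: leq_trans Sy _; have := leq_expl 2 Sle; lia.
have [F [FP FM Fle]] := pairsum_avg g MP.
have gF : pairsum g F <= 16 * M ^ 2 * t ^ 4.
  have P0 : 0 < #|P| ^ 2 by rewrite expn_gt0; lia.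
  rewrite -(leq_pmul2r P0); apply: leq_trans Fle _.
  have : pairsum g P <= 16 * #|P| ^ 2 * t ^ 4.
    rewrite pairsumD; have := leq_mul h2 (leqnn (2 * t ^ 2)); lia.
  by rewrite -(leq_pmul2r (_ : 0 < M ^ 2)) ?expn_gt0 ?M0 // => h; apply: leq_trans h _; lia.
rewrite pairsumD in gF; exists F; split=> //.
- exact: trivIsetS FP Ptriv.
- by move=> A /(subsetP FP)/PP[].
- exact: leq_trans (leq_addr _ _) gF.
have t20 : 0 < 2 * t ^ 2 by rewrite muln_gt0 expn_gt0 t0.
rewrite -(leq_pmul2r t20); have := leq_trans (leq_addl _ _) gF; lia.
Qed.
End Regular.

(** * Choosing representatives that see only the majority colour *)

Section Representatives.
Variables (T I : finType) (e : rel T).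
Hypothesis esym : symmetric e.
Variables (J : {set I}) (D : I -> {set T}) (R : rel I) (t M : nat).
Hypotheses (t0 : 0 < t) (JM : #|J| <= M).
Hypothesis Dt : {in J, forall i, #|D i| = t}.
Hypothesis Rsym : symmetric R.
Hypothesis mism : {in J &, forall i j, i != j ->
  16 * M ^ 2 * (\sum_(p in D i) \sum_(q in D j) (e p q != R i j : nat)) <= t ^ 2}.

Definition typical j q :=
  [forall i in J, (i != j) ==> (4 * M * #|[set p in D i | e p q != R i j]| <= t)].

(** Markov's inequality: by [mism], each other blob makes at most [t / (4 * M)] vertices of [D j]
    atypical, and there are at most [M] blobs. *)
Lemma card_atypical j : j \in J -> 4 * #|[set q in D j | ~~ typical j q]| <= t.
Proof.
move=> jJ; have M0 : 0 < M by apply: leq_trans JM; apply/card_gt0P; exists j.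
pose bad i := [set q in D j | t < 4 * M * #|[set p in D i | e p q != R i j]|].
have hbad i : i \in J -> i != j -> 4 * M * #|bad i| <= t.
  move=> iJ ij; rewrite -(leq_pmul2r t0) -[t in _ * t]mul1n.
  have : #|bad i| * t <= 4 * M * \sum_(p in D i) \sum_(q in D j) (e p q != R i j : nat).
    rewrite exchange_big big_distrr /= -sum_nat_const.
    rewrite [X in _ <= X](bigID (mem (bad i))) /=; apply: leq_trans _ (leq_addr _ _).
    rewrite [X in _ <= X](eq_bigl (mem (bad i))); last first.
      by move=> q; rewrite !inE; case: (q \in D j).
    apply: leq_sum => q; rewrite inE => /andP[_ /ltnW h]; apply: leq_trans h _.
    rewrite leq_mul2l -sum1dep_card big_mkcondr /=; apply/orP; right.
    by apply: leq_sum => p _; case: (_ != _).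
  move/(leq_mul (leqnn (4 * M))); have := mism iJ jJ ij; rewrite mul1n.
  set sm := \sum_(_ in _) _; lia.
suff : M * (4 * #|[set q in D j | ~~ typical j q]|) <= M * t by rewrite leq_pmul2l.
apply: (@leq_trans (\sum_(i in J :\ j) (4 * M * #|bad i|))).
  rewrite -big_distrr /= mulnA [M * 4]mulnC leq_mul2l; apply/orP; right.
  apply: leq_trans (leq_card_bigcup _ _); apply: subset_leq_card; apply/subsetP=> q.
  rewrite inE => /andP[qD]; rewrite negb_forall_in => /exists_inP[i iJ].
  rewrite negb_imply -ltnNge => /andP[ij h]; apply/bigcupP; exists i; first by rewrite !inE ij.
  by rewrite inE qD.
apply: (@leq_trans (\sum_(i in J :\ j) t)).
  by apply: leq_sum => i; rewrite !inE => /andP[ij iJ]; apply: hbad.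
by rewrite sum_nat_const leq_mul2r (leq_trans _ JM) ?orbT // subset_leq_card // subsetDl.
Qed.

Lemma typical_card i j q : i \in J -> i != j -> typical j q ->
  4 * M * #|[set p in D i | e p q != R i j]| <= t.
Proof. by move=> iJ ij /forall_inP/(_ i iJ)/implyP; apply. Qed.

(** Choose the [z j] one by one among typical vertices. Atypicality excludes at most [t / 4]
    vertices of [D j], and so do the mismatches with the earlier choices, which are typical
    themselves; fewer than [t] are excluded. The same count of mismatches with all [z i] gives the
    last clause. *)
Lemma ex_representatives : J != set0 -> exists z : I -> T,
  [/\ {in J, forall i, z i \in D i},
      {in J &, forall i j, i != j -> e (z i) (z j) = R i j} &
      {in J, forall j, 3 * t <= 4 *
        #|[set p in D j | [forall i in J, (i != j) ==> (e p (z i) == R j i)]]|}].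
Proof.
case/set0Pn=> j0 j0J; have M0 : 0 < M by apply: leq_trans JM; apply/card_gt0P; exists j0.
have /card_gt0P[x0 _] : 0 < #|D j0| by rewrite Dt.
have claim n : forall K : {set I}, K \subset J -> #|K| = n -> exists z : I -> T,
    {in K, forall i, z i \in D i /\ typical i (z i)} /\
    {in K &, forall i j, i != j -> e (z i) (z j) = R i j}.
  elim: n => [|n IH] K KJ Kn.
    by exists (fun=> x0); rewrite (cards0_eq Kn); split=> i; rewrite inE.
  have /card_gt0P[j jK] : 0 < #|K| by rewrite Kn.
  have jJ := subsetP KJ j jK; have K'J := subset_trans (subsetDl K [set j]) KJ.
  have [z [zP zR]] := IH _ K'J ltac:(by have := cardsD1 j K; rewrite jK Kn => -[]).
  have [q [qD qt qR]] : exists q, [/\ q \in D j, typical j q &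
      {in K :\ j, forall i, e (z i) q = R i j}].
    pose B := [set q in D j | ~~ typical j q] :|:
      \bigcup_(i in K :\ j) [set q in D j | e q (z i) != R j i].
    have hB : 2 * M * #|B| <= M * t.
      apply: leq_trans (leq_mul (leqnn _) (leq_card_setU _ _)) _.
      have h1 := leq_mul (leqnn M) (card_atypical jJ).
      have h2 : 4 * M * #|\bigcup_(i in K :\ j) [set q in D j | e q (z i) != R j i]| <= M * t.
        apply: leq_trans (leq_mul (leqnn _) (leq_card_bigcup _ _)) _.
        rewrite big_distrr /=; apply: (@leq_trans (\sum_(i in K :\ j) t)).
          apply: leq_sum => i iK; have [_ ti] := zP i iK.
          by apply: typical_card => //; case/setD1P: iK; rewrite eq_sym.
        by rewrite sum_nat_const leq_mul2r (leq_trans _ JM) ?orbT // subset_leq_card.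
      move: h1 h2; set c1 := #|_|; set c2 := #|_|; lia.
    have [q qD qB] : exists2 q, q \in D j & q \notin B.
      apply/subsetPn; apply/negP=> /subset_leq_card; rewrite (Dt jJ) => h.
      have := leq_trans (leq_mul (leqnn (2 * M)) h) hB; nia.
    exists q; move: qB; rewrite !inE qD /= negb_or negbK => /andP[qt qR]; split=> // i iK.
    move: qR; apply: contraNeq => h; apply/bigcupP; exists i => //.
    by rewrite inE qD esym Rsym h.
  exists (fun i => if i == j then q else z i); split=> [i iK|i i' iK i'K ii'].
    case: eqVneq => [->//|ij]; apply: zP; by rewrite !inE ij.
  case: eqVneq => [ij|ij]; case: eqVneq => [i'j|i'j].
  - by rewrite ij i'j eqxx in ii'.
  - by rewrite esym ij Rsym; apply: qR; rewrite !inE i'j.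
  - by rewrite i'j; apply: qR; rewrite !inE ij.
  by apply: zR; rewrite ?inE ?ij ?i'j.
have [z [zP zR]] := claim _ _ (subxx J) erefl.
exists z; split=> // [i /zP[]//|j jJ].
set G := [set p in D j | _].
have := cardsID G (D j); have GD : G \subset D j by apply/subsetP=> p; rewrite inE => /andP[].
rewrite (setIidPr GD) (Dt jJ).
suff : M * (4 * #|D j :\: G|) <= M * t by rewrite leq_pmul2l //; lia.
apply: (@leq_trans (\sum_(i in J :\ j) t)); last first.
  by rewrite sum_nat_const leq_mul2r (leq_trans _ JM) ?orbT // subset_leq_card // subsetDl.
apply: (@leq_trans (\sum_(i in J :\ j)
   (4 * M * #|[set p in D j | e p (z i) != R j i]|))); last first.
  apply: leq_sum => i /setD1P[ij iJ]; apply: typical_card; rewrite // 1?eq_sym //.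
  by case: (zP i iJ).
rewrite -big_distrr /= mulnA [M * 4]mulnC leq_mul2l; apply/orP; right.
apply: leq_trans (leq_card_bigcup _ _); apply: subset_leq_card; apply/subsetP=> q.
case/setDP=> qD; rewrite inE qD /= negb_forall_in => /exists_inP[i iJ].
rewrite negb_imply => /andP[ij h]; apply/bigcupP; exists i; first by rewrite !inE ij.
by rewrite inE qD.
Qed.

End Representatives.

(** * Vertices with both colours towards a blob *)

Section Mixed.
Variables (T I : finType) (e : rel T).
Hypothesis esym : symmetric e.

Definition mixed (A : {set T}) v :=
  [exists q in A, exists q' in A, [&& q != v, q' != v, e v q & ~~ e v q']].

Lemma not_mixed A v : ~~ mixed A v ->
  exists b, {in A, forall q, q != v -> e v q = b}.
Proof.
move=> nm; case: (boolP [exists q in A, (q != v) && e v q]).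
  case/exists_inP=> q qA /andP[qv vq]; exists true => q' q'A q'v.
  apply: contraNT nm => h; apply/exists_inP; exists q => //.
  by apply/exists_inP; exists q' => //; apply/and4P.
rewrite negb_exists_in => /forall_inP h; exists false => q qA qv.
by have := h q qA; rewrite qv => /negbTE.
Qed.

Variables (J : {set I}) (D : I -> {set T}) (R : rel I) (z : I -> T) (S : {set T}) (d : nat).
Hypothesis zD : {in J, forall i, z i \in D i}.
Hypothesis Dz : {in J &, forall i j p, p \in D j -> i != j -> e p (z i) = R j i}.
Hypothesis Ddis : {in J &, forall i j, i != j -> [disjoint D i & D j]}.
Hypothesis DS : {in J, forall i, D i \subset S}.

(* A shattering of the z_i extends by the new point v: given a trace, replace
   p I = z_i by a vertex of D i whose colour to v is the prescribed one. *)
Lemma not_bishattered_mixed v : v \in S -> ~ bishattered e d.+1 S ->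
  ~ bishattered e d [set z i | i in J & mixed (D i) v].
Proof.
move=> vS nsh [x [p [xZ pZ px epx]]]; apply: nsh.
have hJ (K : {set 'I_d.+1}) : exists i, [&& i \in J, mixed (D i) v &
    z i == p [set j | lift ord0 j \in K]].
  have /imsetP[i] := pZ [set j | lift ord0 j \in K].
  by rewrite !inE => /andP[iJ im] ->; exists i; rewrite iJ im eqxx.
have hq (K : {set 'I_d.+1}) : exists q, [&& q \in D (xchoose (hJ K)), q != v &
    e v q == (ord0 \in K)].
  have /and3P[_ /exists_inP[q qD /exists_inP[q' q'D /and4P[qv q'v vq vq']]] _] := xchooseP (hJ K).
  case: (ord0 \in K); first by exists q; rewrite qD qv vq.
  by exists q'; rewrite q'D q'v (negPf vq').
have xJ j : exists2 i, i \in J & x j = z i.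
  by have /imsetP[i] := xZ j; rewrite inE => /andP[iJ _] ->; exists i.
exists (fun k => if unlift ord0 k is Some j then x j else v).
exists (fun K => xchoose (hq K)).
(* The old coordinates survive the replacement: [x j] represents a blob other than that of the
   replaced vertex, and by [Dz] all vertices of one blob see it in the same colour. *)
have key K j : (x j != xchoose (hq K)) && (e (x j) (xchoose (hq K)) == (lift ord0 j \in K)).
  have /and3P[qD _ _] := xchooseP (hq K); move: (xchoose _) qD => q.
  have /and3P[] := xchooseP (hJ K); move: (xchoose _) => i iJ _ /eqP zi qD.
  have [i' i'J xi'] := xJ j; rewrite xi'.
  have ii' : i' != i.
    apply/eqP=> h; have := px [set j | lift ord0 j \in K] j.
    by rewrite xi' h -zi eqxx.
  apply/andP; split.
    apply/eqP=> h; have := disjoint_setI0 (Ddis i'J iJ ii') => /setP/(_ q).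
    by rewrite !inE qD -h zD.
  rewrite esym (Dz i'J iJ qD ii') -(Dz i'J iJ (zD iJ) ii') zi -xi' esym epx.
  by rewrite inE.
split=> [k|K|K k|K k].
- case: unliftP => [j|] _; last by [].
  by have [i iJ ->] := xJ j; apply: subsetP (DS iJ) _ (zD iJ).
- have /and3P[qD _ _] := xchooseP (hq K); have /and3P[iJ _ _] := xchooseP (hJ K).
  exact: subsetP (DS iJ) _ qD.
- case: unliftP => [j|] _; first by have /andP[] := key K j; rewrite eq_sym.
  by have /and3P[] := xchooseP (hq K).
case: unliftP => [j|] ->; first by have /andP[_ /eqP] := key K j.
by have /and3P[_ _ /eqP] := xchooseP (hq K).
Qed.
End Mixed.

(** * The Erdos-Hajnal property *)

Lemma leq_pairsum (I : finType) (g : I -> I -> nat) (A : {set I}) i j :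
  i \in A -> j \in A -> i != j -> g i j <= pairsum g A.
Proof.
move=> iA jA ij; rewrite /pairsum (bigD1 i) //= (bigD1 j) /=; last by rewrite jA eq_sym.
by rewrite -addnA leq_addr.
Qed.

(** The product of the two sizes, not their maximum, is the quantity that adds up over the blocks of
    a blockade. *)
Definition EH_exponent d C := forall (T : finType) (e : rel T) (U : {set T}),
  symmetric e -> ~ bishattered e d U -> exists W : bool -> {set T},
    (forall b, W b \subset U /\ homog e b (W b)) /\
    #|U| <= (#|W true| * #|W false|) ^ C.

Lemma homogS (T : finType) (e : rel T) b (W W' : {set T}) :
  W' \subset W -> homog e b W -> homog e b W'.
Proof.
move=> /subsetP W'W /homogP h; apply/homogP=> x y xW yW; apply: h; exact: W'W.
Qed.

Lemma big_bigcup_disjoint (I T : finType) (K : {set I}) (D : I -> {set T}) (E : T -> nat) :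
  {in K &, forall i j, i != j -> [disjoint D i & D j]} ->
  \sum_(x in \bigcup_(i in K) D i) E x = \sum_(i in K) \sum_(x in D i) E x.
Proof.
move=> dis; pose D' i := if i \in K then D i else set0.
have -> : \bigcup_(i in K) D i = \bigcup_i D' i by rewrite big_mkcond.
rewrite [RHS]big_mkcond /= partition_disjoint_bigcup; last first.
  move=> i j ij; rewrite /D' -setI_eq0; case: (boolP (i \in K)) => iK; last by rewrite set0I.
  case: (boolP (j \in K)) => jK; last by rewrite setI0.
  by rewrite setI_eq0; apply: dis.
by apply: eq_bigr => i _; rewrite /D'; case: ifP => // _; rewrite big_set0.
Qed.

Definition blockade (T : finType) (e : rel T) (S : {set T}) k t :=
  exists b (K : {set {set T}}) (B : {set T} -> {set T}),
  [/\ #|K| = k, {in K, forall i, B i \subset S /\ t <= 2 * #|B i|},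
      {in K &, forall i j, i != j -> [disjoint B i & B j]} &
      {in K &, forall i j, i != j -> {in B i & B j, forall p q, e p q = b}}].

Lemma EH_exponent_homog d C (T : finType) (e : rel T) (U : {set T}) q :
  0 < C -> EH_exponent d C -> symmetric e -> ~ bishattered e d U -> q ^ (2 * C) <= #|U| ->
  exists b (W : {set T}), [/\ W \subset U, homog e b W & #|W| = q].
Proof.
move=> C0 EHd esym nsh Uq; have [W [WP Ule]] := EHd T e U esym nsh.
have {Uq Ule} : q ^ (2 * C) <= (#|W true| * #|W false|) ^ C by apply: leq_trans Ule.
rewrite expnM leq_exp2r // => h.
have [b hb] : exists b, q <= #|W b|.
  have [h1|h1] := leqP q #|W true|; first by exists true.
  by exists false; nia.
have [W' W'W W'q] := ex_subset_card hb; have [WU Wb] := WP b.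
by exists b, W'; split=> //; [apply: subset_trans W'W WU | apply: homogS Wb].
Qed.

(** * One round: a sparser subset or a blockade *)

Section Step.
Variables (T : finType) (e : rel T).
Hypothesis esym : symmetric e.

Lemma cnt_sym b (A B : {set T}) : cnt e b A B = cnt e b B A.
Proof.
rewrite /cnt exchange_big; apply: eq_bigr => p _; apply: eq_bigr => q _.
by rewrite esym.
Qed.

Variables (S : {set T}) (F : {set {set T}}) (z : {set T} -> T) (R : rel {set T}).
Variables (D : {set T} -> {set T}) (t : nat).
Hypothesis t0 : 0 < t.
Hypothesis FS : {in F, forall A : {set T}, [/\ A \subset S, #|A| = t, D A \subset A,
  3 * t <= 4 * #|D A| & z A \in D A]}.
Hypothesis Ftriv : trivIset F.
Hypothesis Dz : {in F &, forall i j p, p \in D j -> i != j -> e p (z i) = R j i}.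

Let Fdis : {in F &, forall i j : {set T}, i != j -> [disjoint i & j]}.
Proof. by move=> i j iF jF; have /trivIsetP := Ftriv; apply. Qed.

Let Ddis : {in F &, forall i j, i != j -> [disjoint D i & D j]}.
Proof.
move=> i j iF jF ij; have [_ _ Di _ _] := FS iF; have [_ _ Dj _ _] := FS jF.
by apply: disjointWl Di _; apply: disjointWr Dj _; apply: Fdis.
Qed.

Let z_inj : {in F &, injective z}.
Proof.
move=> i j iF jF zij; apply/eqP/negPn/negP=> ij.
have [_ _ _ _ zi] := FS iF; have [_ _ _ _ zj] := FS jF.
by have /disjoint_setI0/setP/(_ (z i)) := Ddis iF jF ij; rewrite !inE zi zij zj.
Qed.

(** The representatives of the blobs mixed to [v] have smaller dimension by [not_bishattered_mixed],
    so [EH_exponent d C] gives a homogeneous set among them; the colour between two representatives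
    is the [R]-value of their blobs. *)
Lemma mixed_many d C v q : 0 < C -> EH_exponent d C -> ~ bishattered e d.+1 S -> v \in S ->
  q ^ (2 * C) <= #|[set i in F | mixed e (D i) v]| ->
  exists b (K : {set {set T}}), [/\ K \subset F, #|K| = q &
    {in K &, forall i j, i != j -> R i j = b}].
Proof.
move=> C0 EHd nsh vS; set Z := [set i in F | _] => Zq.
have nshZ : ~ bishattered e d (z @: Z).
  apply: (not_bishattered_mixed esym (R := R) (S := S)) => //.
  - by move=> i /FS[].
  - by move=> i /FS[iS _ Di _ _]; apply: subset_trans Di iS.
have cZ : #|z @: Z| = #|Z|.
  by apply: card_in_imset => i j; rewrite !inE => /andP[iF _] /andP[jF _]; apply: z_inj.
rewrite -cZ in Zq; have [b [W [WZ /homogP Wb Wq]]] := EH_exponent_homog C0 EHd esym nshZ Zq.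
pose K := [set i in F | z i \in W].
have KF : K \subset F by apply/subsetP=> i; rewrite inE => /andP[].
have eW : W = z @: K.
  apply/setP=> w; apply/idP/imsetP=> [wW|[i]]; last by rewrite inE => /andP[_ iW] ->.
  have /imsetP[i] := subsetP WZ w wW; rewrite inE => /andP[iF _] ew.
  by exists i; rewrite // inE iF -ew.
exists b, K; split=> //.
  by rewrite -Wq eW card_in_imset // => i j /(subsetP KF) iF /(subsetP KF); apply: z_inj.
move=> i j; rewrite !inE => /andP[iF iW] /andP[jF jW] ij.
have [_ _ _ _ zi] := FS iF; rewrite -(Dz jF iF zi); last by rewrite eq_sym.
by apply: Wb => //; apply: contraNneq ij => /z_inj ->.
Qed.

(** Pairs of colour [b] inside the [4 * Y] blobs number at most [4 * Y * t ^ 2], and those across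
    are fewer still, so [8 * Y * t ^ 2] bounds the total. The union has at least [3 * t * Y]
    vertices, and 8 is below 9. *)
Lemma union_restricted b (K : {set {set T}}) Y M : K \subset F ->
  #|K| = 4 * Y -> 0 < Y -> #|K| <= M ->
  {in K &, forall i j, i != j -> cnt e b i j * (16 * M ^ 2) <= t ^ 2} ->
  let S' := \bigcup_(i in K) D i in
  [/\ S' \subset S, t <= #|S'| & num_colored e b S' * Y <= #|S'| ^ 2].
Proof.
move=> KF KY Y0 KM hcnt S'; have KF' := subsetP KF.
have Kdis : {in K &, forall i j, i != j -> [disjoint D i & D j]}.
  by move=> i j /KF' iF /KF' jF; apply: Ddis.
have cS' : #|S'| = \sum_(i in K) #|D i|.
  rewrite -sum1_card (big_bigcup_disjoint _ Kdis).
  by apply: eq_bigr => i _; rewrite sum1_card.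
have S'ge : 3 * t * #|K| <= 4 * #|S'|.
  rewrite cS' mulnC -sum_nat_const big_distrr /=.
  by apply: leq_sum => i /KF'/FS[].
split.
- by apply/bigcupsP=> i /KF'/FS[iS _ Di _ _]; apply: subset_trans Di iS.
- nia.
have Dt i : i \in K -> #|D i| <= t.
  by move=> /KF'/FS[_ <- Di _ _]; apply: subset_leq_card.
have ncle : num_colored e b S' <= \sum_(i in K) (t ^ 2 + \sum_(j in K | j != i) cnt e b i j).
  pose G p q := if q == p then 0 else (e p q == b : nat).
  rewrite /num_colored /pairsum (big_bigcup_disjoint _ Kdis) /=; apply: leq_sum => i iK.
  apply: (@leq_trans (\sum_(p in D i) \sum_(j in K) \sum_(q in D j) G p q)).
    apply: leq_sum => p _; rewrite -(big_bigcup_disjoint _ Kdis) big_mkcondr /=.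
    by apply: leq_sum => q _; rewrite /G; case: eqVneq.
  rewrite exchange_big (bigD1 i) //=; apply: leq_add.
    apply: (@leq_trans (\sum_(p in D i) \sum_(q in D i) 1)).
      by apply: leq_sum => p _; apply: leq_sum => q _; rewrite /G; case: eqP => // _; case: eqP.
    by rewrite !sum_nat_const muln1 mulnn leq_expl // Dt.
  apply: leq_sum => j /andP[jK ji]; rewrite /cnt.
  have [_ _ /subsetP Di _ _] := FS (KF' _ iK); have [_ _ /subsetP Dj _ _] := FS (KF' _ jK).
  rewrite [X in _ <= X](bigID (mem (D i))) /=; apply: leq_trans _ (leq_addr _ _).
  rewrite [X in _ <= X](eq_bigl (mem (D i))); last first.
    by move=> p /=; case: (boolP (p \in D i)); rewrite ?andbF // => /Di ->.
  apply: leq_sum => p _.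
  rewrite [X in _ <= X](bigID (mem (D j))) /=; apply: leq_trans _ (leq_addr _ _).
  rewrite [X in _ <= X](eq_bigl (mem (D j))); last first.
    by move=> q /=; case: (boolP (q \in D j)); rewrite ?andbF // => /Dj ->.
  by apply: leq_sum => q _; rewrite /G; case: eqP.
have nc2 : num_colored e b S' * (16 * M ^ 2) <=
    \sum_(i in K) (t ^ 2 * (16 * M ^ 2) + \sum_(j in K) t ^ 2).
  apply: leq_trans (leq_mul ncle (leqnn _)) _; rewrite big_distrl /=.
  apply: leq_sum => i iK; rewrite mulnDl leq_add2l big_distrl big_mkcondr /=.
  apply: leq_sum => j jK; case: ifP => // ji; apply: hcnt => //; by rewrite eq_sym.
rewrite !sum_nat_const KY in nc2.
have M0 : 0 < 16 * M ^ 2 by rewrite muln_gt0 expn_gt0; lia.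
have nc3 : num_colored e b S' <= 8 * Y * t ^ 2.
  rewrite -(leq_pmul2r M0); apply: leq_trans nc2 _.
  rewrite KY in KM; have : (4 * Y) ^ 2 <= M ^ 2 by apply: leq_expl.
  rewrite expnMn; move: (t ^ 2) (M ^ 2) => tt m2 hm.
  have h : Y * Y <= 4 * Y * m2 by rewrite mulnn; nia.
  have := leq_mul h (leqnn tt); lia.
rewrite KY in S'ge.
have h : 3 * t * Y <= #|S'| by lia.
apply: leq_trans (leq_expl 2 h); apply: leq_trans (leq_mul nc3 (leqnn Y)) _.
have := leqnn (t * t * (Y * Y)); rewrite -!mulnn; lia.
Qed.

(** Keep in each [D j] the vertices mixed to no other blob of [K]: at most [t / 4] of at least
    [3 * t / 4] are lost. A kept vertex sees another blob in one colour, the one in which it sees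
    the representative, which is [b]. *)
Lemma blockade_of_unmixed (K : {set {set T}}) b : K \subset F ->
  pairsum (fun i j => #|[set v in D j | mixed e (D i) v]|) K * 4 <= t ->
  {in K &, forall i j, i != j -> R i j = b} -> blockade e S #|K| t.
Proof.
move=> KF; set g := (X in pairsum X) => gK Rb; have KF' := subsetP KF.
pose B j := [set v in D j | [forall i in K, (i != j) ==> ~~ mixed e (D i) v]].
exists b, K, B; split=> //.
- move=> j jK; have [jS _ Dj hD _] := FS (KF' _ jK); split.
    by apply/subsetP=> v; rewrite inE => /andP[/(subsetP Dj)/(subsetP jS)].
  have BD : B j \subset D j by apply/subsetP=> v; rewrite inE => /andP[].
  have := cardsID (B j) (D j); rewrite (setIidPr BD).
  suff : #|D j :\: B j| * 4 <= t by lia.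
  apply: leq_trans gK; rewrite leq_mul2r /=.
  apply: (@leq_trans (\sum_(i in K :\ j) g i j)).
    apply: leq_trans (leq_card_bigcup _ _); apply: subset_leq_card; apply/subsetP=> v.
    case/setDP=> vD; rewrite inE vD negb_forall_in => /exists_inP[i iK].
    rewrite negb_imply negbK => /andP[ij mi]; apply/bigcupP; exists i; first by rewrite !inE ij.
    by rewrite inE vD.
  rewrite /pairsum (eq_bigl (fun i => (i \in K) && (i != j))); last first.
    by move=> i; rewrite !inE andbC.
  rewrite big_mkcondr; apply: leq_sum => i iK; case: ifP => // ij.
  by rewrite (bigD1 j) /= ?leq_addr // jK eq_sym.
- move=> i j iK jK ij; have BD k : B k \subset D k by apply/subsetP=> v; rewrite inE => /andP[].
  exact: disjointWl (BD i) (disjointWr (BD j) (Ddis (KF' _ iK) (KF' _ jK) ij)).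
move=> i j iK jK ij p q; rewrite !inE => /andP[pD /forall_inP pm] /andP[qD _].
have iF := KF' _ iK; have jF := KF' _ jK.
have Dne w k : w \in D j -> k \in D i -> w != k.
  move=> wD kD; apply/eqP=> h; have /disjoint_setI0/setP/(_ k) := Ddis iF jF ij.
  by rewrite !inE kD -h wD.
have /implyP/(_ _)/not_mixed[|c hc] := pm j jK; first by rewrite eq_sym.
have [_ _ _ _ zj] := FS jF.
rewrite (hc q qD) ?(Dne q p) // -(hc _ zj) ?Dne // (Dz jF iF pD) ?Rb // eq_sym //.
Qed.

End Step.

Lemma leq_pairsumr (I : finType) (g h : I -> I -> nat) (A : {set I}) :
  {in A &, forall i j, i != j -> g i j <= h i j} -> pairsum g A <= pairsum h A.
Proof.
move=> gh; apply: leq_sum => i iA; apply: leq_sum => j /andP[jA ji].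
by apply: gh; rewrite // eq_sym.
Qed.

Lemma pairsumD (I : finType) (g h : I -> I -> nat) (A : {set I}) :
  pairsum (fun i j => g i j + h i j) A = pairsum g A + pairsum h A.
Proof. by rewrite /pairsum -big_split; apply: eq_bigr => i _; rewrite -big_split. Qed.

Lemma pairsumMr (I : finType) (g : I -> I -> nat) (A : {set I}) c :
  pairsum (fun i j => g i j * c) A = pairsum g A * c.
Proof. by rewrite /pairsum big_distrl; apply: eq_bigr => i _; rewrite big_distrl. Qed.

(* One round of the iteration: either the colour b' becomes rarer, with density
   1/Y, or S contains a blockade.  For c = true the rarity of b in S makes the
   blockade homogeneous; with k = 2 this is automatic. *)
Lemma structure_or_blockade d C (T : finType) (e : rel T) (S : {set T}) b y k Y sg (c : bool)
    (M := 8 * k ^ 2 * (4 * Y) ^ (2 * C)) (t := #|S| %/ (2 * 2 ^ (packexp d.+1 * sg))) :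
  0 < C -> EH_exponent d C -> symmetric e -> ~ bishattered e d.+1 S -> 1 < k -> 0 < Y ->
  (if c then 128 * k ^ 2 <= y else k == 2) -> 512 * M ^ 4 <= 2 ^ sg -> 0 < t ->
  num_colored e b S * y <= #|S| ^ 2 ->
  (exists b' (S' : {set T}), [/\ S' \subset S, t <= #|S'| & num_colored e b' S' * Y <= #|S'| ^ 2])
  \/ blockade e S k t.
Proof.
move=> C0 EHd esym nsh k1 Y0 cy Msg t0 Sy; pose th := (4 * Y) ^ (2 * C).
have eM : M = 8 * k ^ 2 * th by []; clearbody M.
have th0 : 0 < th by rewrite expn_gt0 muln_gt0 Y0.
have Yth : 4 * Y <= th by rewrite /th -[X in X <= _]expn1 leq_pexp2l; lia.
have M0 : 0 < M by rewrite eM !muln_gt0 th0 andbT /=; lia.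
have k2k : k <= k ^ 2 by rewrite -mulnn leq_pmulr; lia.
have kM : k <= M by rewrite eM; clear -k2k th0; nia.
have thM : th <= M by rewrite eM; nia.
have MM4 : M <= M ^ 4 by rewrite -[X in X <= _]expn1 leq_pexp2l.
have sg0 : 0 < sg by case: (sg) Msg => //; rewrite expn0; lia.
have M0l : 0 < M <= 2 ^ (packexp d.+1 * sg).
  rewrite M0; apply: (@leq_trans (2 ^ sg)); first lia.
  by rewrite leq_exp2l // leq_pmull // packexp_gt0.
have [F [Ftriv FM FP impF cntF]] := ex_regular_pieces esym sg0 nsh t0 Sy M0l.
rewrite -/t in FP impF cntF.
pose R (A B : {set T}) := cnt e false A B <= cnt e true A B.
have Rsym : symmetric R by move=> A B; rewrite /R !(cnt_sym esym _ A).
have t2 A B : A \in F -> B \in F -> cnt e true A B + cnt e false A B = t ^ 2.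
  by move=> /FP[_ At] /FP[_ Bt]; rewrite cnt_add At Bt mulnn.
(* [R] is the majority colour, with at least [t ^ 2 / 2] pairs; the bound on the product of the two
   counts therefore bounds the minority, and [512 * M ^ 4] is chosen to give this constant. *)
have minor A B : A \in F -> B \in F -> A != B -> cnt e (~~ R A B) A B * (16 * M ^ 2) <= t ^ 2.
  move=> AF BF AB.
  have h1 : cnt e true A B * cnt e false A B * 2 ^ sg <= 16 * M ^ 2 * t ^ 4.
    apply: leq_trans impF; rewrite leq_mul2r.
    by rewrite (leq_pairsum (fun A B => cnt e true A B * cnt e false A B)) ?orbT.
  have h2 : cnt e (~~ R A B) A B * t ^ 2 <= 2 * (cnt e true A B * cnt e false A B).
    have := t2 A B AF BF; rewrite /R; case: (leqP (cnt e false A B)) => /= h <-;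
      by move: h; move: (cnt e true A B) (cnt e false A B) => p q; clear; nia.
  set m := cnt _ _ _ _ in h2 *.
  have h3 : m * t ^ 2 * (512 * M ^ 4) <= 2 * (16 * M ^ 2 * t ^ 4).
    apply: leq_trans (leq_mul h2 Msg) _; rewrite -mulnA leq_mul2l; exact: h1.
  have p0 : 0 < 32 * M ^ 2 * t ^ 2 by rewrite !muln_gt0 M0 t0.
  rewrite -(leq_pmul2r p0); lia.
have maj A B : A \in F -> B \in F -> t ^ 2 <= 2 * cnt e (R A B) A B.
  by move=> AF BF; have := t2 A B AF BF; rewrite /R; case: (leqP (cnt e false A B)) => /= h; lia.
have [z [zD zR zc]] : exists z : {set T} -> T, [/\ {in F, forall i : {set T}, z i \in i},
      {in F &, forall i j, i != j -> e (z i) (z j) = R i j} &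
      {in F, forall j : {set T}, 3 * t <= 4 *
        #|[set p in j | [forall i in F, (i != j) ==> (e p (z i) == R j i)]]|}].
  apply: (@ex_representatives T _ e esym F id R t M t0); rewrite ?FM //.
  - by move=> A /FP[].
  - move=> A B AF BF AB; rewrite mulnC; apply: leq_trans (minor A B AF BF AB).
    rewrite leq_mul2r /cnt; apply/orP; right; apply: leq_sum => p _; apply: leq_sum => q _.
    by case: (e p q); case: (R A B).
  by rewrite -card_gt0 FM.
pose D (A : {set T}) := [set p in A | [forall i in F, (i != A) ==> (e p (z i) == R A i)]].
have FS : {in F, forall A : {set T}, [/\ A \subset S, #|A| = t, D A \subset A,
    3 * t <= 4 * #|D A| & z A \in D A]}.
  move=> A AF; have [AS At] := FP A AF; split=> //.
  - by apply/subsetP=> p; rewrite inE => /andP[].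
  - exact: zc.
  rewrite inE zD //=; apply/forall_inP=> i iF; apply/implyP=> iA; rewrite zR //.
  by rewrite eq_sym.
have Dz : {in F &, forall i j p, p \in D j -> i != j -> e p (z i) = R j i}.
  move=> i j iF jF p; rewrite inE => /andP[_ /forall_inP/(_ i iF)/implyP h] ij.
  exact/eqP/h.
case: (boolP [exists v in S, th <= #|[set i in F | mixed e (D i) v]|]).
  case/exists_inP=> v vS vth; left.
  have [b' [K [KF Kq KR]]] := mixed_many esym FS Ftriv Dz C0 EHd nsh vS vth.
  exists (~~ b'), (\bigcup_(i in K) D i).
  apply: (union_restricted t0 FS Ftriv KF Kq Y0 (M := M)); first by rewrite Kq; lia.
  move=> i j iK jK ij; rewrite -(KR i j iK jK ij); apply: minor => //; exact: (subsetP KF).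
rewrite negb_exists_in => /forall_inP few; right.
(* [g1] counts the vertices lost to mixedness, and [g2] marks the pairs of blobs with the unwanted
   majority [b] when [c] holds. Averaging [g1 + g2 * t] yields [k] blobs of total weight at most
   [t / 4]: the losses are small and no pair is marked. *)
pose g1 i j := #|[set v in D j | mixed e (D i) v]|.
pose g2 i j := (c && (R i j == b) : nat).
have g1F : pairsum g1 F <= M * (t * th).
  rewrite -FM -sum_nat_const /pairsum.
  apply: (@leq_trans (\sum_(i in F) \sum_(j in F) g1 i j)).
    by apply: leq_sum => i _; rewrite big_mkcondr; apply: leq_sum => j _; case: ifP.
  rewrite exchange_big /=; apply: leq_sum => j jF.
  apply: (@leq_trans (\sum_(v in D j) th)); last first.
    rewrite sum_nat_const leq_mul2r; have [_ <- Dj _ _] := FS j jF.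
    by rewrite subset_leq_card ?orbT.
  apply: (@leq_trans (\sum_(v in D j) #|[set i in F | mixed e (D i) v]|)); last first.
    apply: leq_sum => v vD; apply: ltnW; rewrite ltnNge; apply: few.
    by have [/subsetP jS _ /subsetP Dj _ _] := FS j jF; apply/jS/Dj.
  rewrite /g1; under eq_bigr => i _ do rewrite -sum1dep_card.
  rewrite (exchange_big_dep (mem (D j))) /=; last by move=> i v _ /andP[].
  apply: leq_sum => v vD; rewrite -sum1dep_card.
  by rewrite [X in X <= _](eq_bigl (fun i => (i \in F) && mixed e (D i) v)) // => i; rewrite vD.
have g2F : pairsum g2 F * y <= 16 * M ^ 2.
  have p0 : 0 < t ^ 2 by rewrite expn_gt0 t0.
  rewrite -(leq_pmul2r p0); apply: (@leq_trans (2 * (pairsum (cnt e b) F * y))); last by lia.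
  rewrite mulnAC mulnA leq_mul2r -pairsumMr [2 * _]mulnC -pairsumMr.
  rewrite leq_pairsumr ?orbT // => i j iF jF ij; rewrite /g2; case: c {cy g2} => //=.
  case: eqP => [<-|//]; rewrite mul1n mulnC; exact: maj.
have kF : 1 <= k <= #|F| by rewrite FM kM; lia.
have [K [KF Kk]] := pairsum_avg (fun i j => g1 i j + g2 i j * t) kF.
rewrite !pairsumD !pairsumMr FM => gK.
have key : 4 * (pairsum g1 K + pairsum g2 K * t) <= t.
  have p0 : 0 < M ^ 2 by rewrite expn_gt0 M0.
  rewrite -(leq_pmul2r p0); move: gK; set pK := (X in X * M ^ 2 <= _) => gK.
  have h1 : 8 * (pairsum g1 F * k ^ 2) <= M ^ 2 * t.
    have -> : M ^ 2 * t = M * (t * th) * (8 * k ^ 2).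
      rewrite -mulnn -!mulnA; congr (_ * _); rewrite eM; clear; lia.
    have := leq_mul g1F (leqnn (8 * k ^ 2)); clear; lia.
  have h2 : 8 * (pairsum g2 F * k ^ 2) <= M ^ 2.
    case: c cy @g2 g2F {gK pK} => cy g2 g2F; last first.
      have -> : pairsum g2 F = 0 by apply: big1 => i _; apply: big1.
      by rewrite mul0n muln0.
    have := leq_mul (leqnn (pairsum g2 F)) cy; lia.
  have := leq_mul h2 (leqnn t); move: gK h1; clear; lia.
have g1K : pairsum g1 K * 4 <= t by clear -key; lia.
rewrite -Kk.
have fin b' := blockade_of_unmixed t0 FS Ftriv Dz KF g1K (b := b').
have KF' := subsetP KF.
case: c cy @g2 g2F gK key => cy g2 g2F gK key.
  apply: (fin (~~ b)) => i j iK jK ij.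
  have := leq_pairsum g2 iK jK ij; rewrite /g2 /=.
  case: (eqVneq (R i j) b) => [_ h|]; last by case: (R i j); case: b {Sy cntF fin g2 g2F gK key}.
  have : t <= pairsum g2 K * t by apply: leq_pmull; exact: h.
  by move: key t0; move: (pairsum g2 K * t) (pairsum g1 K) => x y'; clear; lia.
have /cards2P[A1 [A2 [A12 eK]]] : #|K| == 2 by rewrite Kk.
apply: (fin (R A1 A2)) => i j; rewrite eK !inE => /orP[/eqP->|/eqP->] /orP[/eqP->|/eqP->];
  by rewrite ?eqxx // Rsym.
Qed.

(** * Superadditivity of the product along blockades *)

Section Best.
Variables (T : finType) (e : rel T).
Implicit Types (S U W B : {set T}) (b : bool).

Lemma homog0 b : homog e b set0.
Proof. by apply/homogP=> x y; rewrite inE. Qed.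

Definition best b U := [arg max_(W > set0 | (W \subset U) && homog e b W) #|W|].

Lemma bestP b U : best b U \subset U /\ homog e b (best b U).
Proof.
rewrite /best; case: arg_maxnP => [|W /andP[] //]; by rewrite sub0set homog0.
Qed.

Lemma best_max b U W : W \subset U -> homog e b W -> #|W| <= #|best b U|.
Proof.
rewrite /best => WU Wb; case: arg_maxnP => [|W' _ h]; first by rewrite sub0set homog0.
by apply: h; rewrite WU.
Qed.

Definition prodhom U := #|best true U| * #|best false U|.

Lemma prodhom_ge2 U x y : x \in U -> y \in U -> x != y -> symmetric e -> 2 <= prodhom U.
Proof.
move=> xU yU xy esym.
have h b : 1 <= #|best b U|.
  rewrite -(cards1 x); apply: best_max; first by rewrite sub1set.
  by apply/homogP=> u v; rewrite !inE => /eqP-> /eqP->; rewrite eqxx.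
have h2 : 2 <= #|best (e x y) U|.
  have <- : #|[set x; y]| = 2 by rewrite cards2 xy.
  apply: best_max; first by rewrite subUset !sub1set xU.
  apply/homogP=> u v; rewrite !inE => /orP[/eqP->|/eqP->] /orP[/eqP->|/eqP->];
    by rewrite ?eqxx // esym.
rewrite /prodhom; have := h true; have := h false; move: h2; case: (e x y); nia.
Qed.

Lemma prodhom_gt0 U : 0 < #|U| -> 0 < prodhom U.
Proof.
case/card_gt0P=> x xU.
have h b : 1 <= #|best b U|.
  rewrite -(cards1 x); apply: best_max; first by rewrite sub1set.
  by apply/homogP=> u v; rewrite !inE => /eqP-> /eqP->; rewrite eqxx.
by rewrite /prodhom muln_gt0 !h.
Qed.

Lemma prodhom_small U c : symmetric e -> #|U| <= 2 ^ c -> #|U| <= prodhom U ^ c.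
Proof.
move=> esym Uc; have [U1|U2] := leqP #|U| 1.
  have [->//|U0] := posnP #|U|.
  by apply: leq_trans U1 _; rewrite expn_gt0 prodhom_gt0.
case/card_gt1P: U2 => x [y [xU yU xy]].
apply: leq_trans Uc _; apply: leq_expl; exact: prodhom_ge2 xU yU xy esym.
Qed.

(** The largest [b]-sets of the blocks unite to a [b]-set of [U], while a largest set of the other
    colour in one block is used alone; so the products of the blocks sum to at most that of [U]. The
    block with the least product loses a factor [k] there, against at most [k ^ c] in size. *)
Lemma prodhom_blockade S U k t c : S \subset U -> 1 < k -> blockade e S k t ->
  (forall B, B \subset S -> t <= 2 * #|B| -> 0 < #|B| /\ #|U| <= #|B| * k ^ c) ->
  (forall B, B \subset U -> #|B| < #|U| -> #|B| <= prodhom B ^ c) -> #|U| <= prodhom U ^ c.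
Proof.
move=> SU k1 [b [K [B [Kk BP Bdis Bb]]]] big IH.
have K0 : 0 < #|K| by rewrite Kk; lia.
have [i iK ile] := ex_leq_avg (fun i => prodhom (B i)) K0.
have BS j : j \in K -> B j \subset U by move=> /BP[h _]; apply: subset_trans h SU.
have Bpos j : j \in K -> 0 < #|B j| by move=> /BP[h /(big _ h)[]].
have Bsmall j : j \in K -> #|B j| < #|U|.
  move=> jK; have [j' j'K jj'] : exists2 j', j' \in K & j != j'.
    have : 1 < #|K| by rewrite Kk.
    case/card_gt1P=> x [y [xK yK xy]]; case: (eqVneq j x) => [->|]; first by exists y.
    by exists x.
  apply: (@leq_trans (#|B j :|: B j'|)); last by rewrite subset_leq_card // subUset !BS.
  rewrite cardsU (disjoint_setI0 (Bdis j j' jK j'K jj')) cards0 subn0 -addn1.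
  by rewrite leq_add2l Bpos.
pose W := \bigcup_(j in K) best b (B j).
have Wdis : {in K &, forall j j', j != j' -> [disjoint best b (B j) & best b (B j')]}.
  move=> j j' jK j'K jj'; have [bj _] := bestP b (B j); have [bj' _] := bestP b (B j').
  exact: disjointWl bj (disjointWr bj' (Bdis j j' jK j'K jj')).
have WU : #|W| <= #|best b U|.
  apply: best_max.
    apply/bigcupsP=> j jK; have [bj _] := bestP b (B j); exact: subset_trans bj (BS j jK).
  apply/homogP=> x y /bigcupP[j jK xj] /bigcupP[j' j'K yj'] xy.
  have [/subsetP bj /homogP hj] := bestP b (B j).
  have [jj'|jj'] := eqVneq j j'; first by apply: hj => //; rewrite jj'.
  have [/subsetP bj' _] := bestP b (B j').
  by apply: (Bb j j' jK j'K jj'); [apply: bj|apply: bj'].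
have sumle : \sum_(j in K) prodhom (B j) <= prodhom U.
  have -> : prodhom U = #|best b U| * #|best (~~ b) U|.
    by rewrite /prodhom; case: (b); rewrite //= mulnC.
  apply: leq_trans (leq_mul WU (leqnn _)).
  rewrite -sum1_card (big_bigcup_disjoint _ Wdis) big_distrl /=; apply: leq_sum => j jK.
  rewrite sum1_card.
  have -> : prodhom (B j) = #|best b (B j)| * #|best (~~ b) (B j)|.
    by rewrite /prodhom; case: (b); rewrite //= mulnC.
  rewrite leq_mul2l; apply/orP; right; have [bj hj] := bestP (~~ b) (B j).
  by apply: best_max hj; apply: subset_trans bj (BS j jK).
have [Bi ti] := BP i iK; have [_ Ui] := big _ Bi ti.
apply: leq_trans Ui _; apply: leq_trans (leq_mul (IH _ (BS i iK) (Bsmall i iK)) (leqnn _)) _.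
by rewrite -expnMn leq_expl // (leq_trans _ sumle) // -Kk.
Qed.

End Best.

(** * Iteration and induction on the dimension *)

Lemma bishatteredS (T : finType) (e : rel T) d (U U' : {set T}) :
  U' \subset U -> bishattered e d U' -> bishattered e d U.
Proof.
move=> /subsetP UU [x [p [xU pU px ep]]]; exists x, p; split=> // i; exact: UU.
Qed.

(** Any vertex of [U] bishatters zero points, so [U] is empty. *)
Lemma EH_exponent0 : EH_exponent 0 1.
Proof.
move=> T e U _ nsh; exists (fun=> set0); split=> [b|]; first by rewrite sub0set homog0.
rewrite leqNgt cards0; apply/negP=> /card_gt0P[x xU]; apply: nsh.
by exists (fun=> x), (fun=> x); split=> // [I []|I []].
Qed.

(** The size lost in a round with [k = 2 ^ nu] and [Y = 2 ^ (18 * nu)] is at most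
    [2 ^ (nu * stepexp d C)]: the condition [512 * M ^ 4 <= 2 ^ sg] holds for
    [sg = nu * (29 + 160 * C)], and 3 absorbs constant factors. *)
Definition stepexp d C := 3 + packexp d.+1 * (29 + 160 * C).

Lemma structure_or_blockade_pow2 d C (T : finType) (e : rel T) (S : {set T}) b nu (c : bool) :
  0 < C -> EH_exponent d C -> symmetric e -> ~ bishattered e d.+1 S -> 0 < nu -> c || (nu == 1) ->
  2 ^ (nu * stepexp d C) <= #|S| ->
  num_colored e b S * (if c then 2 ^ (9 * nu) else 1) <= #|S| ^ 2 ->
  exists t, (forall B : {set T}, t <= 2 * #|B| ->
      0 < #|B| /\ #|S| <= #|B| * 2 ^ (nu * stepexp d C)) /\
  ((exists b' (S' : {set T}), [/\ S' \subset S, t <= #|S'| &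
      num_colored e b' S' * 2 ^ (9 * (2 * nu)) <= #|S'| ^ 2])
  \/ blockade e S (2 ^ nu) t).
Proof.
move=> C0 EHd esym nsh nu0 cnu Sbig Sy.
pose sg := nu * (29 + 160 * C); pose l := 2 ^ (packexp d.+1 * sg); pose t := #|S| %/ (2 * l).
have el : 2 ^ (nu * stepexp d C) = 2 ^ (3 * nu) * l.
  rewrite -expnD /sg /stepexp; congr (2 ^ _); lia.
have l0 : 0 < l by rewrite expn_gt0.
have n8 : 8 <= 2 ^ (3 * nu) by rewrite (_ : 8 = 2 ^ (3 * 1)) // leq_exp2l // leq_mul2l.
have Sl : 8 * l <= #|S| by apply: leq_trans Sbig; rewrite el leq_mul2r n8 orbT.
have t0 : 0 < t by rewrite divn_gt0; lia.
have St : #|S| <= 4 * l * t.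
  have := ltn_ceil #|S| (_ : 0 < 2 * l); rewrite -/t => /(_ _); clearbody t; clear -l0 t0; nia.
exists t; split=> [B tB|].
  split; first lia.
  rewrite el; apply: leq_trans St _; apply: (@leq_trans (#|B| * (8 * l))); first nia.
  by rewrite leq_mul2l leq_mul2r n8 !orbT.
have h := @structure_or_blockade d C T e S b (if c then 2 ^ (9 * nu) else 1) (2 ^ nu)
  (2 ^ (9 * (2 * nu))) sg c C0 EHd esym nsh.
apply: h => //.
- by rewrite -[X in X < _](expn0 2) ltn_exp2l.
- by rewrite expn_gt0.
- case: c cnu {Sy} => [_|/= /eqP->//].
  rewrite (_ : 128 = 2 ^ 7) // -expnM -expnD leq_exp2l //; lia.
have e1 : 4 * 2 ^ (9 * (2 * nu)) = 2 ^ (2 + 9 * (2 * nu)) by rewrite expnD.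
have e2 : 8 * (2 ^ nu) ^ 2 = 2 ^ (3 + nu * 2) by rewrite expnD -expnM.
rewrite e1 e2 -expnM -expnD -expnM (_ : 512 = 2 ^ 9) // -expnD leq_exp2l // /sg.
by have : C <= nu * C; [rewrite leq_pmull | clear -nu0; lia].
Qed.

Lemma num_colored_leq (T : finType) (e : rel T) b (S : {set T}) : num_colored e b S <= #|S| ^ 2.
Proof.
rewrite /num_colored /pairsum -mulnn -sum_nat_const; apply: leq_sum => x _.
rewrite big_mkcondr -sum1_card; apply: leq_sum => y _; by case: ifP => // _; exact: leq_b1.
Qed.

(** Induction on the size of [U]. A blockade in any round finishes by superadditivity; otherwise the
    rounds [nu = 2 ^ j] continue until [S] is so sparse in one colour that it contains a homogeneous
    set of size a fixed root of [#|U|]. *)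
Lemma EH_exponentS d C : 0 < C -> EH_exponent d C -> EH_exponent d.+1 (4 * stepexp d C).
Proof.
move=> C0 EHd; set a := stepexp d C.
suff main (T : finType) (e : rel T) : symmetric e -> forall N (U : {set T}), #|U| <= N ->
    ~ bishattered e d.+1 U -> #|U| <= prodhom e U ^ (4 * a).
  move=> T e U esym nsh; exists (fun b => best e b U); split=> [b|]; first exact: bestP.
  exact: (main _ _ esym _ _ (leqnn _)).
move=> esym; elim=> [|N IH] U UN nsh; first by apply: leq_trans UN _.
have IH' (B : {set T}) : B \subset U -> #|B| < #|U| -> #|B| <= prodhom e B ^ (4 * a).
  move=> BU Bl; apply: IH; first by lia.
  by move=> h; apply: nsh; apply: bishatteredS h.
have [//|Unot] := leqP #|U| (prodhom e U ^ (4 * a)).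
have nob (S : {set T}) nu t : 0 < nu -> S \subset U -> #|U| <= #|S| * 2 ^ (nu * a) ->
  (forall B : {set T}, t <= 2 * #|B| -> 0 < #|B| /\ #|S| <= #|B| * 2 ^ (nu * a)) ->
  ~ blockade e S (2 ^ nu) t.
  move=> nu0 SU US tP blk; suff : #|U| <= prodhom e U ^ (4 * a) by lia.
  apply: (prodhom_blockade SU _ blk) => [|B _ /tP[B0 Bl]|//].
    by rewrite -[X in X < _](expn0 2) ltn_exp2l.
  split=> //; apply: leq_trans US _; apply: leq_trans (leq_mul Bl (leqnn _)) _.
  rewrite -mulnA -expnD -expnM leq_mul2l leq_exp2l //; apply/orP; right; nia.
suff : #|U| <= prodhom e U ^ (4 * a) by rewrite leqNgt Unot.
(* The loss exponents of rounds 0 to [j - 1] are [2 ^ i * a], which sum to less than [2 ^ j * a]. At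
   [j = 0] no sparsity is known yet. *)
pose inv j b (S : {set T}) := [/\ S \subset U, #|U| <= #|S| * 2 ^ (2 ^ j * a) &
  num_colored e b S * (if 0 < j then 2 ^ (9 * 2 ^ j) else 1) <= #|S| ^ 2].
have step j b S : inv j b S -> 2 ^ (2 * (2 ^ j * a)) <= #|U| -> exists b' S', inv j.+1 b' S'.
  move=> [SU US Sy] Ubig; have nu0 : 0 < 2 ^ j by rewrite expn_gt0.
  have nshS : ~ bishattered e d.+1 S by move=> h; apply: nsh; apply: bishatteredS h.
  have Sbig : 2 ^ (2 ^ j * a) <= #|S|.
    have p0 : 0 < 2 ^ (2 ^ j * a) by rewrite expn_gt0.
    by rewrite -(leq_pmul2r p0) -expnD addnn -mul2n (leq_trans Ubig).
  have cnu : (0 < j) || (2 ^ j == 1) by case: (j).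
  have [t [tP [[b' [S' [S'S S't S'y]]]|blk]]]
    := structure_or_blockade_pow2 C0 EHd esym nshS nu0 cnu Sbig Sy.
    exists b', S'; split; first exact: subset_trans S'S SU.
      have [] := tP S'; first by lia.
      move=> _ h; apply: leq_trans US _; apply: leq_trans (leq_mul h (leqnn _)) _.
      rewrite -mulnA -expnD leq_mul2l leq_exp2l // expnS; apply/orP; right; lia.
    by rewrite expnS.
  by case: (nob S _ t nu0 SU US tP).
have exj : exists j, #|U| < 2 ^ (2 * (2 ^ j * a)).
  exists #|U|; apply: (leq_trans (ltn_expl #|U| (_ : 1 < 2))) => //.
  rewrite leq_exp2l //; have := ltn_expl #|U| (_ : 1 < 2); rewrite /a /stepexp; nia.
case: (ex_minnP exj) => j hj jmin.
have invj i : i <= j -> exists b S, inv i b S.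
  elim: i => [|i IHi] ij.
    exists true, U; split; rewrite ?subxx ?leq_pmulr ?expn_gt0 //= muln1; exact: num_colored_leq.
  have [b [S Sinv]] := IHi (ltnW ij); apply: (step _ _ _ Sinv).
  by rewrite leqNgt; apply/negP=> /jmin; lia.
(* If [j] is 0 or 1, then [#|U|] is at most [2 ^ (4 * a)] and a single pair of vertices gives
   enough. *)
case: (posnP j) => [j0'|jpos].
  apply: prodhom_small => //; apply: ltnW; apply: leq_trans hj _.
  rewrite j0' leq_exp2l // expn0; lia.
case: j jpos hj jmin invj => // i _ hj jmin invj.
case: (posnP i) => [i0|ipos].
  apply: prodhom_small => //; apply: ltnW; apply: leq_trans hj _.
  rewrite i0 leq_exp2l // expn1; lia.
have [b [S [SU US Sy]]] := invj i (leqnSn i); rewrite ipos in Sy.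
have Ubig : 2 ^ (2 * (2 ^ i * a)) <= #|U| by rewrite leqNgt; apply/negP=> /jmin; rewrite ltnn.
have Sbig : 2 ^ (2 ^ i * a) <= #|S|.
  have p0 : 0 < 2 ^ (2 ^ i * a) by rewrite expn_gt0.
  by rewrite -(leq_pmul2r p0) -expnD addnn -mul2n (leq_trans Ubig).
have kS : 1 <= 2 ^ 2 ^ i <= #|S|.
  rewrite expn_gt0 /=; apply: leq_trans Sbig; rewrite leq_exp2l // leq_pmulr //.
have [|W [WS Wb Wk]] := homog_of_num_colored kS Sy.
  by rewrite -expnM ltn_exp2l //; have := expn_gt0 2 i; lia.
have WU : W \subset U := subset_trans WS SU.
have W0 : 0 < #|U| by apply: leq_trans (subset_leq_card WU); rewrite Wk expn_gt0.
have ph : 2 ^ 2 ^ i <= prodhom e U.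
  rewrite -Wk; apply: leq_trans (best_max WU Wb) _.
  have h := prodhom_gt0 e W0; move: h; rewrite /prodhom muln_gt0 => /andP[ht hf].
  by case: (~~ b); rewrite ?leq_pmulr ?leq_pmull.
apply: ltnW; apply: leq_trans hj _; apply: leq_trans (leq_expl _ ph).
rewrite -expnM leq_exp2l // expnS; lia.
Qed.

Lemma ex_EH_exponent d : exists2 C, 0 < C & EH_exponent d C.
Proof.
elim: d => [|d [C C0 EHd]]; first by exists 1 => //; exact: EH_exponent0.
by exists (4 * stepexp d C); [rewrite muln_gt0 /stepexp | exact: EH_exponentS].
Qed.

(** * Hypergraphs *)

Fixpoint twn (r t : nat) : nat :=
  match r with
  | 0 | 1 => t
  | r'.+1 => 2 ^ twn r' t
  end.

Lemma twnS r t : 0 < r -> twn r.+1 t = 2 ^ twn r t.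
Proof. by case: r. Qed.

Lemma twn_ge r t : t <= twn r t.
Proof.
case: r => // r; elim: r => // r IH; rewrite twnS //.
exact: leq_trans IH (ltnW (ltn_expl _ _)).
Qed.

(** One level down the power [c] becomes a factor [c], and [y * c <= y ^ c] for [y] at least 2. *)
Lemma twn_exp_le r x c : 1 < x -> 0 < c -> twn r x ^ c <= twn r (x ^ c).
Proof.
move=> x1 c0; case: r => // r; elim: r => // r IH; rewrite !(@twnS r.+1) // -expnM leq_exp2l //.
apply: leq_trans IH; have t1 : 1 < twn r.+1 x by apply: leq_trans x1 (twn_ge _ _).
case: c c0 => // c _; rewrite expnS leq_mul2l; apply/orP; right.
by apply: leq_trans (ltn_expl c (_ : 1 < 2)) _ => //; apply: leq_expl.
Qed.

Section Hypergraph.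
Variable T : finType.
Implicit Types (E : {set {set T}}) (A S U L W Om f g : {set T}).

(* Here r = k - 1 is the size of the sets whose neighbourhoods are taken. *)
Definition vc_bounded r d E U := forall A, A \subset U -> #|A| = d.+1 ->
  exists2 B : {set T}, B \subset A &
    forall S, S \subset U -> #|S| = r -> nbhd E S :&: A != B.

Definition constant_on k E W b := forall f, f \subset W -> #|f| = k -> (f \in E) = b.

(** The points [x i] are distinct, and the neighbourhoods of the singletons of the [p I] cut out all
    their subsets. *)
Lemma vc_bounded_graph d E U : vc_bounded 1 d E U ->
  ~ bishattered (fun x y => [set x; y] \in E) d.+1 U.
Proof.
move=> vE [x [p [xU pU _ ep]]].
have xinj : injective x.
  by move=> i j xij; have := ep [set i] i; rewrite xij ep !inE eqxx => /eqP->.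
have AU : x @: setT \subset U by apply/subsetP=> _ /imsetP[i _ ->].
have [|B BA] := vE _ AU; first by rewrite card_imset // cardsT card_ord.
pose I := [set i | x i \in B].
move/(_ [set p I]); rewrite sub1set pU cards1 => /(_ isT erefl)/eqP; apply.
apply/setP=> v; rewrite !inE; apply/andP/idP => [[pv /imsetP[i _ ev]]|vB].
  by move: pv; rewrite ev setUC ep inE.
have /imsetP[i _ ev] := subsetP BA v vB; rewrite ev imset_f //; split=> //.
by rewrite setUC ep inE -ev.
Qed.

(** The neighbourhood of [S] in the link of [w] is that of [w |: S] in [E], so the missing trace
    stays missing. *)
Lemma vc_bounded_link r d E U L w : vc_bounded r.+1 d E U -> w \in U -> L \subset U :\ w ->
  vc_bounded r d [set f | w |: f \in E] L.
Proof.
move=> vE wU /subsetD1P[LU wL] A AL Ad; have [B BA hB] := vE A (subset_trans AL LU) Ad.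
exists B => // S SL Sr; have wS : w \notin S by apply: contra wL; apply: (subsetP SL).
have := hB (w |: S); rewrite subUset sub1set wU (subset_trans SL LU) cardsU1 wS Sr.
move/(_ isT erefl); congr (_ :&: _ != _).
by apply/setP=> v; rewrite !inE setUA.
Qed.

(* S is the set of vertices already chosen, Om the set of candidates that are
   indistinguishable over k-subsets of S. *)
Lemma ex_end_homogeneous k E M m S Om :
  #|S| + m <= M ->
  (forall f u u', f \subset S -> #|f| = k -> u \in Om -> u' \in Om ->
    (u |: f \in E) = (u' |: f \in E)) ->
  (2 * 2 ^ M ^ k) ^ m <= #|Om| ->
  exists L w, [/\ L \subset Om :\ w, w \in Om, #|L| = m &
    forall f, f \subset S :|: L -> #|f| = k.+1 -> ~~ (f \subset S) ->
      exists g, [/\ g \subset f, #|g| = k & (f \in E) = (w |: g \in E)]].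
Proof.
elim: m S Om => [|m IH] S Om SM agree Omge.
  have /card_gt0P[w wOm] : 0 < #|Om| by apply: leq_trans Omge.
  exists set0, w; rewrite sub0set cards0; split=> // f.
  by rewrite setU0 => ->.
have N0 : 0 < 2 ^ M ^ k by rewrite expn_gt0.
have Om0 : 0 < #|Om| by apply: leq_trans Omge; rewrite expn_gt0 muln_gt0 N0.
case/card_gt0P: (Om0) => v vOm.
pose X := [set f : {set T} | (f \subset v |: S) & (#|f| == k)].
have S'M : #|v |: S| <= #|S|.+1 by rewrite cardsU1; case: (_ \notin _); lia.
have XM : #|powerset X| <= 2 ^ M ^ k.
  rewrite card_powerset leq_exp2l // cards_draws; apply: leq_trans (bin_leq_exp _ _) _.
  by apply: leq_expl; lia.
pose phi u := [set f in X | u |: f \in E].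
have X0 : 0 < #|powerset X| by rewrite card_powerset expn_gt0.
(* Pigeonhole: the candidates have at most [2 ^ M ^ k] patterns over the [k]-subsets of [v |: S].
   The extra factor 2 in the size bound pays for the removal of [v]. *)
have [Z _ Zge] := ex_geq_avg (fun Z => #|[set u in Om :\ v | phi u == Z]|) X0.
have cOm : \sum_(Z in powerset X) #|[set u in Om :\ v | phi u == Z]| = #|Om :\ v|.
  rewrite -sum1_card (partition_big phi (mem (powerset X))) /=; last first.
    by move=> u _; rewrite powersetE; apply/subsetP=> f; rewrite inE => /andP[].
  by apply: eq_bigr => Z' _; rewrite -sum1_card; apply: eq_bigl => u; rewrite !inE.
set Om' := [set u in _ | _] in Zge; rewrite cOm in Zge.
have Om'v : Om' \subset Om :\ v by apply/subsetP=> u; rewrite inE => /andP[].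
have Om'ge : (2 * 2 ^ M ^ k) ^ m <= #|Om'|.
  have h := leq_trans Zge (leq_mul (leqnn _) XM).
  have := cardsD1 v Om; rewrite vOm => e1.
  have p0 : 0 < (2 * 2 ^ M ^ k) ^ m by rewrite expn_gt0 muln_gt0 N0.
  move: Omge h; rewrite expnS e1; set a := #|Om :\ v|; set c := #|Om'|.
  move: p0; set q := (2 * 2 ^ M ^ k) ^ m; move: (2 ^ M ^ k) N0 @q => n N0 q p0 h1 h2.
  have h3 : 2 * n * q <= 1 + c * n by lia.
  rewrite leqNgt; apply/negP=> h4; have h6 : (1 + c) * n <= q * n by rewrite leq_mul2r h4 orbT.
  have h5 : n <= n * q by rewrite leq_pmulr.
  by move: h3 h5 h6; lia.
have [||L [w [LOm wOm Lm hL]]] := IH (v |: S) Om' _ _ Om'ge; first by lia.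
  move=> f u u' fS fk; rewrite !inE => /andP[_ /eqP hu] /andP[_ /eqP hu'].
  have /setP/(_ f) : phi u = phi u' by rewrite hu hu'.
  by rewrite !inE fS fk eqxx.
have [Lo wL] := subsetD1P LOm.
have LOm' := subset_trans Lo Om'v; have [LO vL] := subsetD1P LOm'.
have /setD1P[wv wO] := subsetP Om'v w wOm.
exists (v |: L), w; split=> //.
- apply/subsetD1P; rewrite subUset sub1set vOm LO; split=> //.
  by rewrite !inE negb_or wv.
- by rewrite cardsU1 vL Lm.
move=> f; rewrite setUCA => fSL fk fS; have [fS'|fS'] := boolP (f \subset v |: S); last first.
  by apply: hL; rewrite // -setUA.
have vf : v \in f.
  apply: contraR fS => vf; apply/subsetP=> x xf; have := subsetP fS' x xf.
  by case/setU1P=> // xv; rewrite -xv xf in vf.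
have fD : f :\ v \subset S by rewrite subDset.
have fDk : #|f :\ v| = k by have := cardsD1 v f; rewrite vf fk => -[].
(* Here [v] is the only vertex of [f] outside [S], and it was indistinguishable from the later
   candidate [w] over [S]. *)
exists (f :\ v); split=> //; first exact: subsetDl.
by rewrite -(agree _ v w fD fDk vOm wO) setD1K.
Qed.

End Hypergraph.

(** * Stepping up the uniformity *)

Definition has_exponent r d K := forall n (T : finType) (E : {set {set T}}) (U : {set T}),
  1 < n -> twn r (n ^ K) <= #|U| -> vc_bounded r d E U ->
  exists b (W : {set T}), [/\ W \subset U, n <= #|W| & constant_on r.+1 E W b].

Lemma has_exponent_graph d : exists2 K, 0 < K & has_exponent 1 d K.
Proof.
have [C C0 EHd] := ex_EH_exponent d.+1; exists (2 * C); first by rewrite muln_gt0.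
move=> n T E U n1 Un vE; have nsh := vc_bounded_graph vE.
have esym : symmetric (fun x y => [set x; y] \in E) by move=> x y; rewrite setUC.
have [b [W [WU /homogP Wb Wn]]] := EH_exponent_homog C0 EHd esym nsh Un.
exists b, W; split=> //; first by rewrite Wn.
move=> f fW /eqP/cards2P[x [y [xy ef]]].
by rewrite ef; apply: Wb => //; apply: (subsetP fW); rewrite ef !inE eqxx ?orbT.
Qed.

(** With [m = twn r (n ^ K)], the Erdos-Rado step needs [(2 * 2 ^ m ^ r.+1) ^ m] vertices, at most
    [2 ^ m ^ r.+3]. That is one more exponential, and [twn_exp_le] moves the power [r.+3] into the
    exponent of [n]. *)
Lemma has_exponentS r d K : 0 < r -> 0 < K -> has_exponent r d K ->
  has_exponent r.+1 d (K * r.+3).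
Proof.
move=> r0 K0 IH n T E U n1 Un vE; pose m := twn r (n ^ K).
have nK : 1 < n ^ K by rewrite -(exp1n K) ltn_exp2r.
have m1 : 1 < m by apply: leq_trans nK (twn_ge _ _).
have mU : (2 * 2 ^ m ^ r.+1) ^ m <= #|U|.
  apply: leq_trans Un; rewrite twnS // expnM -expnS -expnM leq_exp2l //.
  apply: leq_trans (twn_exp_le r nK (_ : 0 < r.+3)) => //; rewrite -/m !expnS.
  have : 0 < m ^ r by rewrite expn_gt0; lia.
  move: (m ^ r) => q q0; nia.
have [||L [w [LU wU Lm hL]]] := @ex_end_homogeneous T r.+1 E m m set0 U _ _ mU.
- by rewrite cards0.
- by move=> f u u'; rewrite subset0 => /eqP->; rewrite cards0.
have [||b [W [WL Wn Wb]]] := IH n T [set f | w |: f \in E] L n1.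
- by rewrite Lm.
- exact: vc_bounded_link vE wU LU.
exists b, W; split=> //.
  by apply: subset_trans WL (subset_trans LU (subsetDl _ _)).
move=> f fW fr; have [||g [gf gr ->]] := hL f _ fr.
- by rewrite set0U; apply: subset_trans fW WL.
- by rewrite subset0 -card_gt0 fr.
by have := Wb g (subset_trans gf fW) gr; rewrite inE.
Qed.

Lemma ex_exponent r d : exists2 K, 0 < K & has_exponent r.+1 d K.
Proof.
elim: r => [|r [K K0 IH]]; first exact: has_exponent_graph.
by exists (K * r.+4); [rewrite muln_gt0 K0 | apply: has_exponentS].
Qed.

(** * Passage to Ramsey numbers and real towers *)

Lemma vc_ramsey_prop_twn k d n K : 1 < k -> 1 < n -> has_exponent k.-1 d K ->
  vc_ramsey_prop k d n (twn k.-1 (n ^ K)).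
Proof.
case: k => // k k1 n1 hK T E Tm _ vE.
have vE' : vc_bounded k d E setT.
  move=> A _ Ad.
  have : ~~ shattered [set nbhd E S | S : {set T} & #|S| == k] A.
    apply/negP=> shA; have := leq_trans (leq_bigmax_cond _ shA) vE.
    by rewrite Ad ltnn.
  rewrite negb_forall => /existsP[B]; rewrite negb_imply => /andP[BA nB].
  exists B => // S _ Sk; apply: contra nB => h; apply/existsP; exists (nbhd E S).
  by rewrite h andbT imset_f // inE Sk.
have [|b [W [_ Wn Wb]]] := hK n T E setT n1 _ vE'; first by rewrite cardsT Tm.
exists W; rewrite Wn andbT; case: b Wb => Wb; apply/orP; [left|right];
  by apply/forallP=> f; apply/implyP=> /andP[fW /eqP fk]; rewrite Wb.
Qed.

Lemma ex_vc_ramsey k d n m : 0 < m -> vc_ramsey_prop k d n m ->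
  exists2 m', is_vc_ramsey k d n m' & m' <= m.
Proof.
move=> m0 hm; pose P m' := (0 < m') && `[< vc_ramsey_prop k d n m' >].
have exP : exists m', P m' by exists m; rewrite /P m0; apply/asboolP.
case: (ex_minnP exP) => m' /andP[m'0 /asboolP hm'] m'min; exists m'.
  by split=> // m'' m''0 hm''; apply: m'min; rewrite /P m''0; apply/asboolP.
by apply: m'min; rewrite /P m0; apply/asboolP.
Qed.

Lemma vc_ramsey_prop1 k d : 1 < k -> vc_ramsey_prop k d 1 1.
Proof.
move=> k1 T E T1 _ _; exists setT; rewrite cardsT T1 andbT; apply/orP; left.
apply/forallP=> f; apply/implyP=> /andP[_ /eqP fk].
by have := max_card f; rewrite fk T1 leqNgt k1.
Qed.

Import Order.TTheory GRing.Theory Num.Theory.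
Local Open Scope ring_scope.

Lemma twr_natr (R : realType) r t : twr r (t%:R : R) = (twn r t)%:R.
Proof.
case: r => // r; elim: r => // r IH.
by rewrite twnS // -[LHS]/(powR 2 (twr r.+1 t%:R)) IH powR_mulrn // natrX.
Qed.

Unset Implicit Arguments.

Theorem mainTheorem5 (R : realType) (d k : nat)
    (hd : (1 <= d)%N) (hk : (3 <= k)%N) :
  exists K : R, 0 < K /\
    forall n : nat, (1 <= n)%N ->
      exists m : nat,
        is_vc_ramsey k d n m /\ m%:R <= twr (k - 1) (n%:R `^ K).
Proof.
have k1 : (1 < k)%N by apply: ltnW.
have [K K0 hK] := ex_exponent k.-2 d.
have ek : k.-2.+1 = k.-1 by case: (k) hk => [|[]].
rewrite ek in hK; exists K%:R; split=> [|n n1]; first by rewrite ltr0n.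
suff [m m0 /andP[hm mle]] : exists2 m, (0 < m)%N &
    `[< vc_ramsey_prop k d n m >] && (m <= twn k.-1 (n ^ K))%N.
  have [m' hm' m'm] := ex_vc_ramsey m0 (asboolW hm).
  exists m'; split=> //; rewrite powR_mulrn // -natrX twr_natr ler_nat subn1.
  exact: leq_trans m'm mle.
(* For [n = 1] a single vertex suffices, as it contains no [k]-subset; [has_exponent] covers [n]
   from 2 on. *)
case: n n1 => [//|[|n]] _.
  exists 1%N => //; rewrite exp1n twn_ge andbT; apply/asboolP; exact: vc_ramsey_prop1.
exists (twn k.-1 (n.+2 ^ K)); last by rewrite leqnn andbT; apply/asboolP/vc_ramsey_prop_twn.
by apply: leq_trans (twn_ge _ _); rewrite expn_gt0.
Qed.
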